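(* Let $x_{k,i}$ be generated by the D-PSGD algorithm described in the context, suppose Assumption 1 of the context holds with $\sigma>0$, and let the step length be $$\gamma=\frac{1}{2L+\sigma\sqrt{K/n}}.$$ If the number of iterations $K$ satisfies $$K\ge\frac{4L^4n^5}{\sigma^6(f(0)-f^*+L)^2}\left(\frac{\sigma^2}{1-\rho}+\frac{9\varsigma^2}{(1-\sqrt{\rho})^2}\right)^2\quad\text{and}\quad K\ge\frac{72L^2n^2}{\sigma^2(1-\sqrt{\rho})^2},$$ then $$\frac{\sum_{k=0}^{K-1}\mathbb{E}\left\|\nabla f\left(\frac{X_k\mathbf{1}_n}{n}\right)\right\|^2}{K}\le\frac{8(f(0)-f^* )L}{K}+\frac{(8f(0)-8f^*+4L)\sigma}{\sqrt{Kn}}.$$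
   Context: Problem: there are $n\ge 2$ nodes; node $i$ has a distribution $\mathcal{D}_i$ and a loss $F_i(x;\xi)$, $x\in\mathbb{R}^N$, differentiable in $x$. Set $f_i(x):=\mathbb{E}_{\xi\sim\mathcal{D}_i}F_i(x;\xi)$ and $f(x):=\frac1n\sum_{i=1}^n f_i(x)$, to be minimized over $\mathbb{R}^N$; $f^*$ is the optimal (minimum) value of $f$. Stochastic gradients are unbiased: $\mathbb{E}_{\xi\sim\mathcal{D}_i}\nabla F_i(x;\xi)=\nabla f_i(x)$ for all $x$ and $i$ (gradients are in $x$). Weight matrix: $W\in\mathbb{R}^{n\times n}$ is symmetric and doubly stochastic ($W_{ij}\in[0,1]$, $W_{ij}=W_{ji}$, $\sum_jW_{ij}=1$ for all $i$). $\lambda_i(\cdot)$ denotes the $i$-th largest eigenvalue. D-PSGD algorithm (step length $\gamma$, weight matrix $W$, $K\ge1$ iterations): start from $x_{0,i}=x_0$ for all nodes $i$. For $k=0,1,\dots,K-1$ each node $i$ draws $\xi_{k,i}\sim\mathcal{D}_i$ (independently across nodes and iterations) and sets $$x_{k+1,i}=\sum_{j=1}^nW_{ij}x_{k,j}-\gamma\nabla F_i(x_{k,i};\xi_{k,i}).$$ Write $X_k:=[x_{k,1}\ \cdots\ x_{k,n}]\in\mathbb{R}^{N\times n}$. $\mathbf{1}_n\in\mathbb{R}^n$ is the all-ones column vector and $\|\cdot\|$ is the Euclidean norm of a vector. Assumption 1: 1. (Lipschitzian gradient) every $f_i$ has an $L$-Lipschitz gradient, $L>0$. 2. (Spectral gap)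 $\rho:=(\max\{|\lambda_2(W)|,|\lambda_n(W)|\})^2<1$. 3. (Bounded variance) $\sigma,\varsigma\ge 0$ are constants with $\mathbb{E}_{\xi\sim\mathcal{D}_i}\|\nabla F_i(x;\xi)-\nabla f_i(x)\|^2\le\sigma^2$ for all $i$ and $x$, and $\frac1n\sum_{i=1}^n\|\nabla f_i(x)-\nabla f(x)\|^2\le\varsigma^2$ for all $x$. 4. (Start from 0) $X_0=0$. *)

(* Defs.v *)
From HB Require Import structures.
From mathcomp Require Import all_boot all_order all_algebra.
From mathcomp Require Import all_classical all_reals all_analysis.

Set Implicit Arguments.
Unset Strict Implicit.
Unset Printing Implicit Defensive.

Import Order.TTheory GRing.Theory Num.Theory.
Import numFieldNormedType.Exports.

Local Open Scope classical_set_scope.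
Local Open Scope ring_scope.

(* The library norm on matrices is the max norm, hence this definition. *)
Definition enorm (R : realType) (N : nat) (x : 'cV[R]_N) : R :=
  Num.sqrt (\sum_(j < N) x j 0 ^+ 2).

(* Vector of partial derivatives; it is only used below for functions that are
   assumed to be (Frechet) differentiable. *)
Definition grad (R : realType) (N : nat) (g : 'cV[R]_N -> R) (x : 'cV[R]_N)
    : 'cV[R]_N :=
  \col_j 'D_(delta_mx j 0) g x.

Definition lipschitz_grad (R : realType) (N : nat) (L : R)
    (g : 'cV[R]_N -> R) : Prop :=
  (forall x, differentiable g x) /\
  (forall x y, enorm (grad g x - grad g y) <= L * enorm (x - y)).

Definition sym_doubly_stochastic (R : realType) (n : nat) (W : 'M[R]_n)
    : Prop :=
  [/\ forall i j, 0 <= W i j <= 1,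
      forall i j, W i j = W j i &
      forall i, \sum_j W i j = 1].

(* The nonincreasing sequence of the real eigenvalues, repeated according to
   algebraic multiplicity. It is the default value [::] when the
   characteristic polynomial does not split over R, which cannot happen for a
   symmetric matrix (see eigenvaluesP). *)
Definition eigenvalues (R : realType) (n : nat) (A : 'M[R]_n) : seq R :=
  xget [::] [set s : seq R | sorted >=%R s
                           /\ char_poly A = \prod_(a <- s) ('X - a%:P)].

(* The i-th largest eigenvalue, where i counts from 1. *)
Definition eigval (R : realType) (n : nat) (A : 'M[R]_n) (i : nat) : R :=
  nth 0 (eigenvalues A) i.-1.

Definition spectral_rho (R : realType) (n : nat) (W : 'M[R]_n) : R :=
  (Num.max `|eigval W 2| `|eigval W n|) ^+ 2.

(* Mutual independence of a finite family of random variables, with possibly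
   different target spaces: the product rule for every subfamily. *)
Definition mutually_independent (R : realType) (d : measure_display)
    (T : measurableType d) (P : probability T R) (I : finType)
    (d' : I -> measure_display) (S : forall i, measurableType (d' i))
    (X : forall i, {RV P >-> S i}) : Prop :=
  forall (J : {set I}) (A : forall i, set (S i)),
    (forall i, measurable (A i)) ->
    P [set w | forall i, i \in J -> A i (X i w)]
      = (\prod_(i in J) P (X i @^-1` A i))%E.

Definition has_distribution (R : realType) (d d' : measure_display)
    (T : measurableType d) (S : measurableType d') (P : probability T R)
    (X : {RV P >-> S}) (Q : probability S R) : Prop :=
  forall A : set S, measurable A -> distribution P X A = Q A.

Definition local_obj (R : realType) (N n : nat) (d : 'I_n -> measure_display)
    (S : forall i, measurableType (d i)) (D : forall i, probability (S i) R)
    (F : forall i, 'cV[R]_N -> S i -> R) (i : 'I_n) (x : 'cV[R]_N) : R :=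
  fine ('E_(D i)[F i x])%E.

Definition global_obj (R : realType) (N n : nat) (d : 'I_n -> measure_display)
    (S : forall i, measurableType (d i)) (D : forall i, probability (S i) R)
    (F : forall i, 'cV[R]_N -> S i -> R) (x : 'cV[R]_N) : R :=
  n%:R^-1 * \sum_(i < n) local_obj D F i x.

Definition stoch_grad (R : realType) (N n : nat) (d : 'I_n -> measure_display)
    (S : forall i, measurableType (d i))
    (F : forall i, 'cV[R]_N -> S i -> R) (i : 'I_n) (x : 'cV[R]_N) (s : S i)
    : 'cV[R]_N :=
  grad (fun y => F i y s) x.

Definition is_minimum (R : realType) (U : Type) (g : U -> R) (m : R) : Prop :=
  (exists x, g x = m) /\ (forall x, m <= g x).

(* dpsgd F W gamma x0 xi k w is the N x n matrix X_k at the outcome w, whose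
   i-th column is x_{k,i}; xi k i is the sample drawn by node i at
   iteration k. *)
Fixpoint dpsgd (R : realType) (N n : nat) (d : 'I_n -> measure_display)
    (S : forall i, measurableType (d i))
    (F : forall i, 'cV[R]_N -> S i -> R) (W : 'M[R]_n) (gamma : R)
    (x0 : 'cV[R]_N) (T : Type) (xi : nat -> forall i, T -> S i)
    (k : nat) (w : T) {struct k} : 'M[R]_(N, n) :=
  if k is k'.+1 then
    let X := dpsgd F W gamma x0 xi k' w in
    \matrix_(a, i) (\sum_(j < n) W i j *: col j X
                    - gamma *: stoch_grad F (col i X) (xi k' i w)) a 0
  else \matrix_(a, i) x0 a 0.

Definition avg_iterate (R : realType) (N n : nat) (X : 'M[R]_(N, n))
    : 'cV[R]_N :=
  n%:R^-1 *: (X *m const_mx 1).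

From mathcomp Require Import spectral complex.

Lemma eigenvaluesP (R : realType) (n : nat) (A : 'M[R]_n) : A^T = A ->
  sorted >=%R (eigenvalues A)
  /\ char_poly A = \prod_(a <- eigenvalues A) ('X - a%:P).
Proof.
move=> symA.
suff [s hs] : exists s : seq R, char_poly A = \prod_(a <- s) ('X - a%:P).
  rewrite /eigenvalues; case: xgetP => [s' _ //|/(_ (sort >=%R s))[]].
  split; first by apply: sort_sorted => x y; exact: le_total.
  by rewrite hs; apply: perm_big; rewrite perm_sym perm_sort.
pose toC := @complex.real_complex_def R (Phant R).
pose A' := map_mx toC A.
have toCconj (x : R) : (toC x)^* = toC x :> complex.complex R.
  by apply/CrealP/complex.complex_realP; exists x.
have [r hr] := closed_field_poly_normal (char_poly A').
rewrite (monicP (char_poly_monic _)) scale1r in hr.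
have realr z : z \in r -> z \is Num.real.
  move=> zr; have : root (char_poly A') z by rewrite hr root_prod_XsubC.
  rewrite -eigenvalue_root_char => /eigenvalueP[v vA v0].
  pose u := map_mx Num.conj v.
  have q0 : (v *m u^T) 0 0 != 0.
    rewrite !mxE psumr_eq0; last by move=> i _; rewrite !mxE mul_conjC_ge0.
    apply: contra v0 => /allP h; apply/eqP/rowP => i; rewrite mxE.
    have := h i (mem_index_enum _); rewrite /= !mxE mul_conjC_eq0.
    by move/eqP.
  have uA : u *m A' = z^* *: u.
    have := congr1 (map_mx Num.conj) vA; rewrite map_mxM map_mxZ => <-.
    congr (_ *m _); apply/matrixP => i j; rewrite !mxE.
    exact: esym (toCconj _).
  have A'T : A'^T = A' by rewrite /A' map_trmx symA.
  apply/CrealP; apply: (mulIf q0).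
  have -> : z * (v *m u^T) 0 0 = (v *m A' *m u^T) 0 0.
    by rewrite vA -scalemxAl [RHS]mxE.
  rewrite -mulmxA -{1}A'T -trmx_mul uA linearZ /= -scalemxAr.
  by rewrite [RHS]mxE.
exists [seq complex.Re z | z <- r].
apply: (@map_poly_inj _ _ toC); rewrite map_char_poly -/A' hr big_map.
rewrite rmorph_prod /= big_seq [RHS]big_seq; apply: eq_bigr => z zr.
by rewrite rmorphB /= map_polyX map_polyC /= /toC complex.RRe_real ?realr.
Qed.

(* Main.v *)
Require Import Defs.
From HB Require Import structures.
From mathcomp Require Import all_boot all_order all_algebra.
From mathcomp Require Import all_classical all_reals all_analysis.
From mathcomp Require Import measurable_realfun spectral complex ring lra.

Set Implicit Arguments.
Unset Strict Implicit.
Unset Printing Implicit Defensive.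

Import Order.TTheory GRing.Theory Num.Theory.
Import numFieldNormedType.Exports.

Local Open Scope classical_set_scope.
Local Open Scope ring_scope.

(** The average iterate xbar_k of the nodes performs an inexact stochastic
    gradient step on f, because the mixing matrix preserves averages.  The
    descent inequality of a function with Lipschitz gradient (descent) then
    gives, along every trajectory (descent_step),
      f (xbar_(k+1)) <= f (xbar_k) - gamma/2 |grad f (xbar_k)|^2
        + gamma L^2 / (2n) V_k + L gamma^2 / 2 |mean noise|^2 + cross term,
    where the dispersion V_k is the sum over the nodes of |x_(k,i) - xbar_k|^2.
    Summing over k telescopes the values of f, and f is bounded below by its
    minimum (sum_full_grad_le).

    Two probabilistic facts are needed.  The noise of node i at step k is
    orthogonal to every square integrable function of the other samples drawn
    up to step k (noise_orth), which kills the cross term and makes the noises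
    of distinct nodes orthogonal, so that their mean has second moment at most
    sigma^2 / n (expect_mean_noise_sqr): this is where averaging over n nodes
    pays.  Orthogonality comes from Fubini's theorem: the joint law of the past
    and of a fresh sample is a product measure, hence the fresh sample can be
    integrated first, with the iterates fixed.  The past is encoded as a
    sigma-algebra on the sample space, for which the iterates are measurable;
    this requires the joint measurability of (a, s) |-> grad F (x a, s), which
    follows from continuity in the first argument (caratheodory_measurable).

    The dispersion is controlled by the spectral gap.  With s = sqrt rho, the
    matrix W contracts vectors of zero sum by the factor s
    (mixing_contraction), and the gradients at the nodes differ from
    grad f (xbar_k) by the dispersion and by the heterogeneity varsigma; a
    weighted Young inequality gives (dispersion_step, expect_dispersion_step)
      E V_(k+1) <= (s + 4 gamma^2 L^2 / (1-s)) E V_k + b,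
    with b proportional to n gamma^2.  The second lower bound on K makes the
    factor at most (1+s)/2, so E V_k <= 2b / (1-s) for all k (geometric_bound),
    and the first lower bound on K makes the contribution of this dispersion
    to the final estimate at most (f(0) - f^* + L) sigma / sqrt(K n)
    (convergence_rate). *)

(** * Spectral gap of a doubly stochastic matrix *)
Lemma char_poly_similar (C : fieldType) n (P D : 'M[C]_n) : P \in unitmx ->
  char_poly (invmx P *m D *m P) = char_poly D.
Proof.
move=> uP; rewrite /char_poly /char_poly_mx.
pose Q := map_mx polyC P; pose Q' := map_mx polyC (invmx P).
have QQ : Q' *m Q = 1%:M by rewrite -map_mxM mulVmx // map_mx1.
have -> : 'X%:M - map_mx polyC (invmx P *m D *m P)
    = Q' *m ('X%:M - map_mx polyC D) *m Q.
  by rewrite mulmxBr mulmxBl !map_mxM scalar_mxC -(mulmxA _%:M) QQ mulmx1.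
rewrite !det_mulmx mulrC mulrA -det_mulmx.
by rewrite (mulmx1C QQ) det1 mul1r.
Qed.

Section dot.
Local Open Scope sesquilinear_scope.

Lemma row_sqr_normE (C : numClosedFieldType) n (u : 'rV[C]_n) :
  (u *m u^t*) 0 0 = \sum_i `|u 0 i| ^+ 2.
Proof. by rewrite !mxE; apply: eq_bigr => i _; rewrite !mxE normCK. Qed.

(** In an orthonormal basis of eigenvectors, e is a multiple of the only basis
    vector with eigenvalue 1, since all the other eigenvalues are less than 1 in
    modulus; a vector v orthogonal to e thus has no component along it, and
    every other component is multiplied by at most r. *)
Lemma normal_contraction (C : numClosedFieldType) n (A : 'M[C]_n)
    (s : seq C) (r : C) (e v : 'rV[C]_n) :
  A \is normalmx -> char_poly A = \prod_(a <- 1 :: s) ('X - a%:P) ->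
  r < 1 -> {in s, forall a, `|a| <= r} ->
  e != 0 -> e *m A = e -> v *m e^t* = 0 ->
  \sum_i `|(v *m A) 0 i| ^+ 2 <= r ^+ 2 * \sum_i `|v 0 i| ^+ 2.
Proof.
move=> nA cA r1 sr e0 eA ve.
set P := spectralmx A; set D := spectral_diag A.
have uP : P \is unitarymx := spectral_unitarymx A.
have uuP := unitarymx_unit uP.
have AE : A = invmx P *m diag_mx D *m P by exact/orthomx_spectralP.
have PP : P *m P^t* = 1%:M by exact/unitarymxP.
have PP' : P^t* *m P = 1%:M by rewrite -invmx_unitary // mulVmx.
have perm : perm_eq (1 :: s) [seq D 0 i | i <- enum 'I_n].
  apply: prod_XsubC_eq; rewrite -cA AE char_poly_similar // char_poly_trig.
    by rewrite big_map -big_enum; apply: eq_bigr => i _; rewrite mxE eqxx mulr1n.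
  exact: diag_mx_is_trig.
have [i0 D0] : exists i0, D 0 i0 = 1.
  have : 1 \in [seq D 0 i | i <- enum 'I_n] by rewrite -(perm_mem perm) mem_head.
  by move=> /mapP[i _ ->]; exists i.
have perm' : perm_eq s [seq D 0 i | i <- rem i0 (enum 'I_n)].
  rewrite -(perm_cons 1); apply: (perm_trans perm).
  have -> : 1 :: [seq D 0 i | i <- rem i0 (enum 'I_n)]
      = [seq D 0 i | i <- i0 :: rem i0 (enum 'I_n)] by rewrite /= D0.
  by apply: perm_map; apply: perm_to_rem; rewrite mem_enum.
have Dr i : i != i0 -> `|D 0 i| <= r.
  move=> ii0; apply: sr; rewrite (perm_mem perm'); apply: map_f.
  by rewrite mem_rem_uniq ?enum_uniq // inE ii0 mem_enum.
pose y := e *m P^t*; pose z := v *m P^t*.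
have mulD (u : 'rV[C]_n) : u *m A = u *m P^t* *m diag_mx D *m P.
  by rewrite {1}AE invmx_unitary // !mulmxA.
have yi i : i != i0 -> y 0 i = 0.
  move=> ii0; have : y *m diag_mx D = y.
    by rewrite -[in RHS](mulmx1 y) -PP mulmxA -[in LHS](mulmx1 (y *m _)) -PP !mulmxA
      -mulD eA /y -(mulmxA e) PP' mulmx1.
  move=> /matrixP/(_ 0 i); rewrite mul_mx_diag mxE => /eqP.
  rewrite -subr_eq0 -{2}(mulr1 (y 0 i)) -mulrBr mulf_eq0 => /orP[/eqP//|].
  rewrite subr_eq0 => /eqP Di1.
  by have := le_lt_trans (Dr i ii0) r1; rewrite Di1 normr1 ltxx.
have y0 : y 0 i0 != 0.
  apply: contra e0 => /eqP y00; have : y = 0.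
    by apply/rowP => i; rewrite [RHS]mxE; case: (eqVneq i i0) => [->|/yi].
  move=> yz; rewrite -(mulmx1 e) -PP' mulmxA -/y yz mul0mx //.
have z0 : z 0 i0 = 0.
  have : (z *m y^t*) 0 0 = 0.
    rewrite /y trmx_mul map_mxM !map_trmx /= trmxK -map_mx_comp.
    rewrite (map_mx_id (@conjCK _)) mulmxA /z -(mulmxA v) PP' mulmx1.
    by rewrite ve mxE.
  have yE i : (y^t*) i 0 = (y 0 i)^* by rewrite 2![in LHS]mxE.
  rewrite mxE (bigD1 i0) //= big1 ?addr0 => [|i /yi yi0]; last first.
    by rewrite yE yi0 conjC0 mulr0.
  by rewrite yE => /eqP; rewrite mulf_eq0 conjC_eq0 (negPf y0) orbF => /eqP.
have nP (u : 'rV[C]_n) : \sum_i `|(u *m P) 0 i| ^+ 2 = \sum_i `|u 0 i| ^+ 2.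
  rewrite -!row_sqr_normE trmx_mul map_mxM mulmxA -(mulmxA u) PP mulmx1 //.
have -> : v = z *m P by rewrite -mulmxA PP' mulmx1.
rewrite mulD -(mulmxA z) PP mulmx1 !nP mulr_sumr; apply: ler_sum => i _.
rewrite mul_mx_diag mxE normrM exprMn mulrC.
case: (eqVneq i i0) => [->|ii0]; first by rewrite z0 normr0 expr0n /= !mulr0.
have := Dr i ii0 => Dir; have r0 := le_trans (normr_ge0 _) Dir.
apply: ler_wpM2r; first by rewrite exprn_ge0.
by rewrite lerXn2r // nnegrE.
Qed.
End dot.

(** The value 1 is an eigenvalue, with eigenvector the all-ones vector.  The
    list of eigenvalues being sorted, all of them but the first lie between the
    last one and the second one, so they are at most sqrt rho < 1 in modulus:
    the first one must be 1. *)
Lemma eigenvalues_split (R : realType) n (W : 'M[R]_n) :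
  (2 <= n)%N -> sym_doubly_stochastic W -> spectral_rho W < 1 ->
  exists2 s : seq R, char_poly W = \prod_(a <- 1 :: s) ('X - a%:P) &
    {in s, forall a, `|a| <= Num.sqrt (spectral_rho W)}.
Proof.
move=> n2 [_ Wsym W1] rho1.
have WT : W^T = W by apply/matrixP => i j; rewrite mxE Wsym.
have [ss cW] := eigenvaluesP WT.
have sz : size (eigenvalues W) = n.
  by apply/eq_add_S; rewrite -(size_prod_XsubC _ id) -cW size_char_poly.
case E : (eigenvalues W) ss cW sz => [|b s] ss cW sz; first by rewrite -sz in n2.
have sE : Num.sqrt (spectral_rho W) = Num.max `|eigval W 2| `|eigval W n|.
  by rewrite sqrtr_sqr ger0_norm // le_max normr_ge0.
have q1 : Num.sqrt (spectral_rho W) < 1.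
  by rewrite -sqrtr1 ltr_sqrt.
have sr : {in s, forall a, `|a| <= Num.sqrt (spectral_rho W)}.
  move=> a /(nthP 0)[i si <-]; rewrite sE le_max /eigval E.
  have szs : size s = n.-1 by rewrite -sz.
  have nE : n.-1 = (size s).-1.+1 by rewrite szs; case: (n) n2 => [|[|]].
  rewrite [2.-1]/= [nth _ _ 1]/= nE [nth _ _ _.+1]/=.
  have ssd : sorted >=%R s by apply: path_sorted ss.
  have trg : transitive (>=%R : rel R) by move=> x y z; apply: ge_trans.
  have h1 : nth 0 s i <= nth 0 s 0.
    apply: (sorted_leq_nth trg (@lexx _ R) 0 ssd) => //.
    by rewrite inE (leq_ltn_trans _ si).
  have h2 : nth 0 s (size s).-1 <= nth 0 s i.
    apply: (sorted_leq_nth trg (@lexx _ R) 0 ssd) => //; rewrite ?inE.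
      by rewrite prednK // (leq_ltn_trans _ si).
    by rewrite -ltnS prednK // (leq_ltn_trans _ si).
  have [p|p] := leP 0 (nth 0 s i).
    by rewrite ger0_norm // (le_trans h1 (ler_norm _)).
  rewrite ltr0_norm //; apply/orP; right.
  apply: (@le_trans _ _ (- nth 0 s (size s).-1)); first by rewrite lerN2.
  by rewrite -normrN ler_norm.
exists s => //; rewrite cW; suff -> : b = 1 by [].
have : 1 \in b :: s.
  rewrite -root_prod_XsubC -cW -eigenvalue_root_char; apply/eigenvalueP.
  exists (const_mx 1).
    apply/rowP => j; rewrite !mxE mulr1 -[RHS](W1 j).
    by apply: eq_bigr => i _; rewrite !mxE mul1r Wsym.
  apply/negP => /eqP/rowP/(_ (Ordinal (ltnW n2))); rewrite !mxE => /eqP.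
  by rewrite oner_eq0.
rewrite inE => /orP[/eqP ->//|/sr]; rewrite normr1 leNgt q1 //.
Qed.

(** The spectral theorem is applied to the complexification of W, the vector e
    of normal_contraction being the all-ones vector. *)
Lemma mixing_contraction (R : realType) n (W : 'M[R]_n) (v : 'I_n -> R) :
  (2 <= n)%N -> sym_doubly_stochastic W -> spectral_rho W < 1 ->
  \sum_i v i = 0 ->
  \sum_i (\sum_j W i j * v j) ^+ 2 <= spectral_rho W * \sum_i v i ^+ 2.
Proof.
move=> n2 hW rho1 v0; have [_ Wsym W1] := hW.
have [s cW sr] := eigenvalues_split n2 hW rho1.
pose toC : {rmorphism R -> complex.complex R} :=
  @complex.real_complex_def R (Phant R).
have rho0 : 0 <= spectral_rho W by rewrite sqr_ge0.
have toCr (x : R) : toC x \is Num.real by apply/complex.complex_realP; exists x.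
have toCn (x : R) : `|toC x| = toC `|x|.
  by rewrite complex.normc_def /= expr0n /= addr0 sqrtr_sqr.
pose A := map_mx toC W; pose e : 'rV[complex.complex R]_n := const_mx 1.
pose z : 'rV_n := \row_i toC (v i).
have nA : A \is normalmx.
  apply: symmetric_normalmx.
    apply/is_hermitianmxP; rewrite expr0 scale1r; apply/matrixP => i j.
    by rewrite !mxE Wsym.
  by apply/mxOverP => i j; rewrite mxE.
have cA : char_poly A = \prod_(a <- 1 :: map toC s) ('X - a%:P).
  by rewrite -map_char_poly cW -(rmorph1 toC) -map_cons big_map map_prod_XsubC.
have := @normal_contraction _ n A (map toC s)
  (toC (Num.sqrt (spectral_rho W))) e z nA cA.
have -> : toC (Num.sqrt (spectral_rho W)) ^+ 2 = toC (spectral_rho W).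
  by rewrite -rmorphXn /= sqr_sqrtr.
have -> : \sum_i `|z 0 i| ^+ 2 = toC (\sum_i v i ^+ 2).
  rewrite rmorph_sum; apply: eq_bigr => i _.
  by rewrite mxE toCn -rmorphXn /= real_normK // num_real.
have -> : \sum_i `|(z *m A) 0 i| ^+ 2 = toC (\sum_i (\sum_j W i j * v j) ^+ 2).
  rewrite rmorph_sum; apply: eq_bigr => i _.
  have -> : (z *m A) 0 i = toC (\sum_j W i j * v j).
    rewrite mxE rmorph_sum; apply: eq_bigr => j _.
    by rewrite !mxE rmorphM Wsym mulrC.
  by rewrite toCn -rmorphXn /= real_normK // num_real.
rewrite -rmorphM /= complex.lecR; apply.
- by rewrite -(rmorph1 toC) complex.ltcR -sqrtr1 ltr_sqrt.
- by move=> _ /mapP[a /sr sa ->]; rewrite toCn complex.lecR.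
- apply/negP => /eqP/rowP/(_ (Ordinal (ltnW n2))); rewrite !mxE => /eqP.
  by rewrite oner_eq0.
- apply/rowP => j; rewrite !mxE -[RHS](rmorph1 toC) -[X in _ = toC X](W1 j).
  rewrite rmorph_sum.
  by apply: eq_bigr => i _; rewrite !mxE mul1r Wsym.
- apply/matrixP => i j; rewrite !mxE -[RHS](rmorph0 toC) -[X in _ = toC X]v0.
  rewrite rmorph_sum.
  by apply: eq_bigr => k _; rewrite !mxE conjC1 mulr1.
Qed.

(** * Functions with Lipschitz gradient *)
Section vectors.
Context (R : realType).

Lemma enorm_sqr N (x : 'cV[R]_N) : enorm x ^+ 2 = \sum_j x j 0 ^+ 2.
Proof. by rewrite sqr_sqrtr // sumr_ge0 // => j _; exact: sqr_ge0. Qed.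

Lemma enorm_ge0 N (x : 'cV[R]_N) : 0 <= enorm x.
Proof. exact: sqrtr_ge0. Qed.

Lemma lipschitz_grad_sqr N L (g : 'cV[R]_N -> R) x y : 0 <= L ->
  lipschitz_grad L g ->
  \sum_j (grad g x j 0 - grad g y j 0) ^+ 2 <= L ^+ 2 * \sum_j (x j 0 - y j 0) ^+ 2.
Proof.
move=> L0 [_ /(_ x y) h].
have E (u v : 'cV[R]_N) : \sum_j (u j 0 - v j 0) ^+ 2 = enorm (u - v) ^+ 2.
  by rewrite enorm_sqr; apply: eq_bigr => j _; rewrite !mxE.
rewrite !E -exprMn lerXn2r // nnegrE ?mulr_ge0 ?enorm_ge0 //.
Qed.

Lemma deriv_dot N (g : 'cV[R]_N -> R) x v : differentiable g x ->
  'D_v g x = \sum_j grad g x j 0 * v j 0.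
Proof.
move=> dg; rewrite deriveE //.
have vE : v = \sum_j v j 0 *: delta_mx j 0.
  rewrite {1}(matrix_sum_delta v); apply: eq_bigr => j _.
  by rewrite big_ord1.
rewrite {1}vE linear_sum; apply: eq_bigr => j _.
by rewrite linearZ /= mxE deriveE // mulrC.
Qed.

(** Along the segment from x to x + v, the difference between g and the
    quadratic upper bound has a nonpositive derivative.  The derivative is
    bounded by Young's inequality rather than by the Cauchy-Schwarz inequality,
    which gives the same constant. *)
Lemma descent N L (g : 'cV[R]_N -> R) x v : 0 < L -> lipschitz_grad L g ->
  g (x + v) <= g x + \sum_j grad g x j 0 * v j 0 + L / 2 * \sum_j v j 0 ^+ 2.
Proof.
move=> L0 lg; have [dg _] := lg.
pose c := \sum_j grad g x j 0 * v j 0; pose s := \sum_j v j 0 ^+ 2.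
pose l (t : R) : 'cV[R]_N := x + t *: v.
pose q : {poly R} := c *: 'X + (L / 2 * s) *: 'X^2.
have dl (t : R) : is_derive t (1 : R) (g \o l) ('D_v g (l t)).
  have E : (fun h : R => h^-1 *: (((g \o l) \o shift t) (h *: (1 : R)) - (g \o l) t))
      = (fun h => h^-1 *: ((g \o shift (l t)) (h *: v) - g (l t))).
    apply/funext => h; congr (_ *: (g _ - _)).
    by rewrite /l /= scalerDl [h%:A]mulr1 addrCA.
  by split; rewrite /derivable /derive E //; exact: diff_derivable.
have dh (t : R) : is_derive t (1 : R) ((g \o l) - horner q)
    ('D_v g (l t) - (deriv q).[t]).
  exact: is_deriveB.
have h10 : ((g \o l) - horner q) 1 <= ((g \o l) - horner q) 0.
  apply: (@ler0_derive1_nincr _ _ 0 1) => //.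
  - move=> t; rewrite in_itv /= => /andP[t0 _]; rewrite derive1E.
    rewrite (@derive_val _ _ _ _ _ _ _ (dh t)) deriv_dot //.
    rewrite /q derivD !derivZ derivX derivXn.
    rewrite !hornerE subr_le0.
    have := lipschitz_grad_sqr (l t) x (ltW L0) lg.
    under [X in _ <= _ * X]eq_bigr do rewrite /l !mxE addrAC subrr add0r exprMn.
    rewrite -mulr_sumr -/s => hl.
    (* Young's inequality with weight L t. *)
    have w0 : 0 < L * t by exact: mulr_gt0.
    have : \sum_j (grad g (l t) j 0 - grad g x j 0) * v j 0 <=
      \sum_j ((2 * (L * t))^-1 * (grad g (l t) j 0 - grad g x j 0) ^+ 2
               + L * t / 2 * v j 0 ^+ 2).
      apply: ler_sum => j _; move: (_ - _) (v j 0) => a b.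
      rewrite -subr_ge0.
      have -> : (2 * (L * t))^-1 * a ^+ 2 + L * t / 2 * b ^+ 2 - a * b
          = (2 * (L * t))^-1 * (a - L * t * b) ^+ 2.
        by field; rewrite !gt_eqF.
      by rewrite mulr_ge0 ?sqr_ge0 // invr_ge0 mulr_ge0 // ltW.
    rewrite big_split /= -!mulr_sumr -/s.
    under eq_bigr do rewrite mulrBl.
    rewrite sumrB -/c lerBlDr => /le_trans; apply.
    rewrite [leRHS]addrC lerD2r.
    have : (2 * (L * t))^-1 * (\sum_j (grad g (l t) j 0 - grad g x j 0) ^+ 2) <=
        (2 * (L * t))^-1 * (L ^+ 2 * (t ^+ 2 * s)).
      by rewrite ler_wpM2l // invr_ge0 mulr_ge0 // ltW.
    have -> : (2 * (L * t))^-1 * (L ^+ 2 * (t ^+ 2 * s)) = L * t / 2 * s.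
      by field; rewrite !gt_eqF.
    by move=> ?; lra.
  - apply: continuous_subspaceT => t; apply: differentiable_continuous.
    by apply/derivable1_diffP; have [] := dh t.
move: h10; rewrite !opprfctE !addrfctE /= /l scale1r scale0r addr0 /q !hornerE.
rewrite lerBlDr addrC => /le_trans; apply.
by rewrite /= !mulr0 oppr0 add0r !mulr1 addrA.
Qed.

End vectors.

(** * Averages over the nodes *)
Section averages.
Context (R : realType) (n : nat).
Hypothesis n0 : (0 < n)%N.

Definition mean (u : 'I_n -> R) : R := n%:R^-1 * \sum_i u i.

Let nR0 : n%:R != 0 :> R. Proof. by rewrite pnatr_eq0 -lt0n. Qed.

Lemma sum_mean u : \sum_i u i = n%:R * mean u.
Proof. by rewrite /mean mulrA divff // mul1r. Qed.

Lemma sum_sub_mean u : \sum_i (u i - mean u) = 0.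
Proof.
by rewrite sumrB sum_mean sumr_const card_ord -[mean u *+ n]mulr_natl subrr.
Qed.

(** Decomposition of the second moment around c into variance and squared bias. *)
Lemma sum_sqr_sub (u : 'I_n -> R) c :
  \sum_i (u i - c) ^+ 2 = \sum_i (u i - mean u) ^+ 2 + n%:R * (mean u - c) ^+ 2.
Proof.
transitivity (\sum_i ((u i - mean u) ^+ 2 + (2 * (mean u - c)) * (u i - mean u)
   + (mean u - c) ^+ 2)).
  by apply: eq_bigr => i _; ring.
rewrite !big_split /= -mulr_sumr sum_sub_mean mulr0 addr0.
by rewrite sumr_const card_ord -[X in _ + X]mulr_natl.
Qed.

Lemma sum_sqr_sub_mean_le (u : 'I_n -> R) c :
  \sum_i (u i - mean u) ^+ 2 <= \sum_i (u i - c) ^+ 2.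
Proof. by rewrite (sum_sqr_sub u c) lerDl mulr_ge0 // sqr_ge0. Qed.

Lemma mean_sqr_le (u : 'I_n -> R) : mean u ^+ 2 <= mean (fun i => u i ^+ 2).
Proof.
rewrite {2}/mean ler_pdivlMl ?ltr0n //.
have -> : \sum_i u i ^+ 2 = \sum_i (u i - 0) ^+ 2.
  by apply: eq_bigr => i _; rewrite subr0.
by rewrite (sum_sqr_sub u 0) subr0 lerDr sumr_ge0 // => i _; exact: sqr_ge0.
Qed.

Lemma eq_mean (u v : 'I_n -> R) : u =1 v -> mean u = mean v.
Proof. by move=> uv; congr (_ * _); apply: eq_bigr => i _. Qed.

Lemma meanB u v : mean (fun i => u i - v i) = mean u - mean v.
Proof. by rewrite /mean sumrB mulrBr. Qed.

Lemma mean_cst c : mean (fun=> c) = c.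
Proof.
by rewrite /mean sumr_const card_ord -[c *+ n]mulr_natl mulrA mulVf // mul1r.
Qed.

Lemma avg_iterateE N (X : 'M[R]_(N, n)) j : avg_iterate X j 0 = mean (X j).
Proof.
rewrite /avg_iterate !mxE; congr (_ * _); apply: eq_bigr => i _.
by rewrite mxE mulr1.
Qed.

Context (N : nat) (L : R) (f_ : 'I_n -> 'cV[R]_N -> R).
Hypotheses (L0 : 0 < L) (lf : forall i, lipschitz_grad L (f_ i)).
Let f x := n%:R^-1 * \sum_i f_ i x.

Lemma avg_diff x : differentiable f x.
Proof.
have -> : f = n%:R^-1 *: (\sum_(i < n) f_ i).
  by apply/funext => y; rewrite /f fct_sumE.
apply: differentiableZ; apply: differentiable_sum => i.
by have [] := lf i.
Qed.

Lemma grad_avg x j : grad f x j 0 = mean (fun i => grad (f_ i) x j 0).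
Proof.
have fE : f = n%:R^-1 *: (\sum_(i < n) f_ i).
  by apply/funext => y; rewrite /f fct_sumE.
rewrite mxE fE deriveZ; last first.
  by apply: derivable_sum => i; apply: diff_derivable; have [] := lf i.
rewrite derive_sum; last by move=> i; apply: diff_derivable; have [] := lf i.
by congr (_ * _); apply: eq_bigr => i _; rewrite mxE.
Qed.

Lemma lipschitz_grad_avg : lipschitz_grad L f.
Proof.
split=> [x|x y]; first exact: avg_diff.
rewrite -(@ler_pXn2r _ 2) ?nnegrE ?mulr_ge0 ?enorm_ge0 ?(ltW L0) //.
rewrite exprMn !enorm_sqr.
apply: (@le_trans _ _
  (\sum_j mean (fun i => (grad (f_ i) x j 0 - grad (f_ i) y j 0) ^+ 2))).
  apply: ler_sum => j _; rewrite !mxE -/(grad f x) -/(grad f y).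
  have -> : 'D_(delta_mx j 0) f x - 'D_(delta_mx j 0) f y
      = mean (fun i => grad (f_ i) x j 0 - grad (f_ i) y j 0).
    by rewrite meanB -!grad_avg !mxE.
  exact: mean_sqr_le.
rewrite /mean -mulr_sumr exchange_big /= ler_pdivrMl ?ltr0n //.
rewrite mulr_natl -[X in _ *+ X]card_ord -sumr_const; apply: ler_sum => i _.
have := lipschitz_grad_sqr x y (ltW L0) (lf i).
by under [X in _ -> _ <= _ * X]eq_bigr do rewrite !mxE.
Qed.

End averages.

(** * One iteration along a fixed trajectory *)

(** The noise of the stochastic gradients is an arbitrary family of vectors nu
    in this part, in which X' is the iterate that follows X. *)
Section one_step.
Context (R : realType) (N n : nat) (W : 'M[R]_n).
Hypotheses (n2 : (2 <= n)%N) (hW : sym_doubly_stochastic W).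
Hypothesis rho1 : spectral_rho W < 1.
Let s := Num.sqrt (spectral_rho W).
Context (L : R) (f_ : 'I_n -> 'cV[R]_N -> R).
Hypotheses (L0 : 0 < L) (lf : forall i, lipschitz_grad L (f_ i)).
Let f x := n%:R^-1 * \sum_i f_ i x.

Let n0 : (0 < n)%N. Proof. exact: ltnW. Qed.
Let nR0 : 0 < n%:R :> R. Proof. by rewrite ltr0n. Qed.
Let s0 : 0 <= s. Proof. exact: sqrtr_ge0. Qed.
Let s1 : s < 1. Proof. by rewrite -sqrtr1 ltr_sqrt. Qed.
Let ss : s ^+ 2 = spectral_rho W. Proof. by rewrite sqr_sqrtr // sqr_ge0. Qed.

Definition dispersion (X : 'M[R]_(N, n)) : R :=
  \sum_a \sum_i (X a i - mean (X a)) ^+ 2.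

Lemma dispersion_ge0 X : 0 <= dispersion X.
Proof. by do 2![apply: sumr_ge0 => ? _]; exact: sqr_ge0. Qed.

Definition local_grad (X : 'M[R]_(N, n)) i a : R := grad (f_ i) (col i X) a 0.
Definition mean_grad X a : R := mean (local_grad X ^~ a).
Definition full_grad (X : 'M[R]_(N, n)) a : R := grad f (avg_iterate X) a 0.

Lemma mean_mixing (u : 'I_n -> R) : mean (fun i => \sum_j W i j * u j) = mean u.
Proof.
have [_ Wsym W1] := hW; congr (_ * _); rewrite exchange_big /=.
apply: eq_bigr => j _; rewrite -mulr_suml.
by under eq_bigr do rewrite Wsym; rewrite W1 mul1r.
Qed.

Lemma local_grad_gap X :
  \sum_a \sum_i (local_grad X i a - grad (f_ i) (avg_iterate X) a 0) ^+ 2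
    <= L ^+ 2 * dispersion X.
Proof.
rewrite /dispersion exchange_big [in leRHS]exchange_big mulr_sumr.
apply: ler_sum => i _.
have := lipschitz_grad_sqr (col i X) (avg_iterate X) (ltW L0) (lf i).
by under [X in _ -> _ <= _ * X]eq_bigr do rewrite -avg_iterateE //;
   under [X in _ <= _ * X -> _]eq_bigr do rewrite mxE.
Qed.

Variables (gamma : R) (X X' : 'M[R]_(N, n)) (nu : 'I_n -> 'I_N -> R).
Hypothesis g0 : 0 <= gamma.
Hypothesis X'E : forall a i,
  X' a i = \sum_j W i j * X a j - gamma * (local_grad X i a + nu i a).

Lemma mean_step a :
  mean (X' a) = mean (X a) - gamma * (mean_grad X a + mean (nu^~ a)).
Proof.
rewrite (eq_mean (X'E a)).
rewrite meanB mean_mixing; congr (_ - _).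
rewrite /mean_grad /mean -mulrDr -big_split /= mulrCA; congr (_ * _).
by rewrite mulr_sumr.
Qed.

(** The inner product of grad f (xbar) with the mean gradient is expanded by
    polarization; the term in the square of the mean gradient has a nonpositive
    coefficient when gamma L <= 1 and is dropped. *)
Lemma descent_step : gamma * L <= 1 ->
  f (avg_iterate X') <= f (avg_iterate X) - gamma / 2 * \sum_a full_grad X a ^+ 2
    + gamma * L ^+ 2 / (2 * n%:R) * dispersion X
    + L * gamma ^+ 2 / 2 * \sum_a mean (nu^~ a) ^+ 2
    + \sum_a (L * gamma ^+ 2 * mean_grad X a - gamma * full_grad X a)
             * mean (nu^~ a).
Proof.
move=> gL.
have -> : avg_iterate X' = avg_iterate X
    + \col_a (- (gamma * (mean_grad X a + mean (nu^~ a)))).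
  by apply/colP => a; rewrite avg_iterateE mean_step -avg_iterateE !mxE.
apply: le_trans (descent _ _ L0 (lipschitz_grad_avg n0 L0 lf)) _.
rewrite -!addrA lerD2l.
have gap : \sum_a (full_grad X a - mean_grad X a) ^+ 2
    <= L ^+ 2 / n%:R * dispersion X.
  rewrite mulrAC ler_pdivlMr // mulrC mulr_sumr.
  apply: le_trans (local_grad_gap X); apply: ler_sum => a _.
  rewrite /full_grad (grad_avg lf) -meanB -ler_pdivlMl //.
  apply: (le_trans (mean_sqr_le n0 _)); rewrite /mean; apply: ler_wpM2l.
    by rewrite invr_ge0 ltW.
  by apply: ler_sum => i _; rewrite -sqrrN opprB.
apply: (@le_trans _ _ (- (gamma / 2 * \sum_a full_grad X a ^+ 2)
    + (gamma / 2 * \sum_a (full_grad X a - mean_grad X a) ^+ 2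
    + (L * gamma ^+ 2 / 2 * \sum_a mean (nu^~ a) ^+ 2
    + \sum_a (L * gamma ^+ 2 * mean_grad X a - gamma * full_grad X a)
             * mean (nu^~ a))))).
  rewrite !mulr_sumr -sumrN -!big_split /=; apply: ler_sum => a _.
  rewrite mxE -/(full_grad X a) /=; move: (full_grad X a) (mean_grad X a) (mean _).
  move=> h m u.
  have k : 0 <= 1 - gamma * L by rewrite subr_ge0.
  have := mulr_ge0 (mulr_ge0 g0 k) (sqr_ge0 m).
  by move=> ?; lra.
rewrite lerD2l lerD2r.
have -> : gamma * L ^+ 2 / (2 * n%:R) * dispersion X
  = gamma / 2 * (L ^+ 2 / n%:R * dispersion X) by field; rewrite gt_eqF.
by rewrite ler_wpM2l // divr_ge0.
Qed.

(** The part of the deviation of node i from the new average that is known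
    before the noise of the current iteration is drawn. *)
Definition drift i a : R := \sum_j W i j * X a j - mean (X a)
  - gamma * (local_grad X i a - mean_grad X a).

(** Convexity of the square with the weights (1 + s) / 2 and (1 - s) / 2,
    followed by the contraction factor s^2 of the mixing:
    2 s^2 / (1 + s) <= s because s <= 1.  These weights, unlike s and 1 - s,
    do not vanish when s = 0. *)
Lemma drift_sqr_le a :
  \sum_i drift i a ^+ 2 <= s * \sum_i (X a i - mean (X a)) ^+ 2
    + 2 * gamma ^+ 2 / (1 - s)
      * \sum_i (local_grad X i a - full_grad X a) ^+ 2.
Proof.
have s1' : 0 < 1 - s by rewrite subr_gt0.
have s2' : 0 < 1 + s by rewrite ltr_wpDr.
pose u i := \sum_j W i j * X a j - mean (X a).
pose v i := local_grad X i a - mean_grad X a.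
have uE i : u i = \sum_j W i j * (X a j - mean (X a)).
  have [_ _ W1] := hW; rewrite /u; under [RHS]eq_bigr do rewrite mulrBr.
  by rewrite sumrB -mulr_suml W1 mul1r.
have hu : \sum_i u i ^+ 2 <= s ^+ 2 * \sum_i (X a i - mean (X a)) ^+ 2.
  under eq_bigr do rewrite uE.
  by rewrite ss; apply: mixing_contraction => //; exact: sum_sub_mean.
have hv : \sum_i v i ^+ 2 <= \sum_i (local_grad X i a - full_grad X a) ^+ 2.
  exact: sum_sqr_sub_mean_le.
have h i : drift i a ^+ 2 <=
    2 / (1 + s) * u i ^+ 2 + 2 * gamma ^+ 2 / (1 - s) * v i ^+ 2.
  rewrite /drift -/(u i) -/(v i); move: (u i) (v i) => p q; rewrite -subr_ge0.
  have -> : 2 / (1 + s) * p ^+ 2 + 2 * gamma ^+ 2 / (1 - s) * q ^+ 2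
      - (p - gamma * q) ^+ 2
    = ((1 - s) * p + (1 + s) * (gamma * q)) ^+ 2 / ((1 + s) * (1 - s)).
    by field; rewrite !gt_eqF.
  by rewrite divr_ge0 ?sqr_ge0 // mulr_ge0 // ltW.
apply: (le_trans (ler_sum _ (fun i _ => h i))).
rewrite big_split /= -!mulr_sumr lerD //; last first.
  by rewrite ler_wpM2l // divr_ge0 ?mulr_ge0 ?sqr_ge0 // ltW.
apply: (@le_trans _ _ (2 / (1 + s) * (s ^+ 2 * \sum_i (X a i - mean (X a)) ^+ 2))).
  by rewrite ler_wpM2l // divr_ge0 // ltW.
rewrite mulrA ler_wpM2r ?sumr_ge0 // => [i _|]; first exact: sqr_ge0.
rewrite mulrAC ler_pdivrMr //; have := mulr_ge0 s0 (ltW s1') => ?; lra.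
Qed.

(** The deviation of a node is the drift minus gamma times the centred noise;
    the drifts of the nodes sum to zero, so that centring does not change their
    inner product with the noise, and centring only decreases the norm of the
    noise. *)
Lemma dispersion_step (vs : R) :
  (forall x, n%:R^-1 * \sum_(i < n) enorm (grad (f_ i) x - grad f x) ^+ 2
     <= vs ^+ 2) ->
  dispersion X' <= (s + 4 * gamma ^+ 2 * L ^+ 2 / (1 - s)) * dispersion X
    + 4 * n%:R * gamma ^+ 2 * vs ^+ 2 / (1 - s)
    - 2 * gamma * (\sum_a \sum_i drift i a * nu i a)
    + gamma ^+ 2 * \sum_a \sum_i nu i a ^+ 2.
Proof.
move=> hvs.
have s1' : 0 < 1 - s by rewrite subr_gt0.
have coord a : \sum_i (X' a i - mean (X' a)) ^+ 2 <=
   \sum_i drift i a ^+ 2 - 2 * gamma * (\sum_i drift i a * nu i a)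
   + gamma ^+ 2 * \sum_i nu i a ^+ 2.
  have d0 : \sum_i drift i a = 0.
    rewrite /drift sumrB -mulr_sumr sum_sub_mean // mulr0 subr0.
    rewrite -(mean_mixing (X a)); exact: sum_sub_mean.
  have E i : X' a i - mean (X' a) = drift i a - gamma * (nu i a - mean (nu^~ a)).
    by rewrite X'E mean_step /drift; ring.
  under eq_bigr do rewrite E.
  have -> : \sum_i (drift i a - gamma * (nu i a - mean (nu^~ a))) ^+ 2
    = \sum_i drift i a ^+ 2 - 2 * gamma * (\sum_i drift i a * nu i a)
      + 2 * gamma * mean (nu^~ a) * (\sum_i drift i a)
      + gamma ^+ 2 * \sum_i (nu i a - mean (nu^~ a)) ^+ 2.
    by rewrite !mulr_sumr -sumrN -!big_split /=; apply: eq_bigr => i _; ring.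
  rewrite d0 mulr0 addr0 lerD2l ler_wpM2l ?sqr_ge0 //.
  apply: (le_trans (sum_sqr_sub_mean_le n0 _ 0)).
  by apply: ler_sum => i _; rewrite subr0.
have grads : \sum_a \sum_i (local_grad X i a - full_grad X a) ^+ 2
    <= 2 * L ^+ 2 * dispersion X + 2 * n%:R * vs ^+ 2.
  apply: (@le_trans _ _ (\sum_a \sum_i (2 * (local_grad X i a
        - grad (f_ i) (avg_iterate X) a 0) ^+ 2
      + 2 * (grad (f_ i) (avg_iterate X) a 0 - full_grad X a) ^+ 2))).
    do 2!(apply: ler_sum => ? _).
    move: (local_grad _ _ _) (grad _ _ _ _) (full_grad _ _) => p q r.
    by rewrite -subr_ge0; have := sqr_ge0 (p - q - (q - r)); nra.
  under eq_bigr do rewrite big_split /= -!mulr_sumr.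
  rewrite big_split /= -!mulr_sumr lerD // -mulrA ler_wpM2l //.
    exact: local_grad_gap.
  rewrite exchange_big /= -ler_pdivrMl //; apply: le_trans (hvs (avg_iterate X)).
  rewrite ler_wpM2l ?invr_ge0 //; apply: ler_sum => i _.
  rewrite enorm_sqr; apply: ler_sum => a _.
  have subE (u v : 'cV[R]_N) : (u - v) a 0 = u a 0 - v a 0 by rewrite !mxE.
  by rewrite subE.
rewrite /dispersion; apply: (le_trans (ler_sum _ (fun a _ => coord a))).
rewrite big_split /= sumrB -!mulr_sumr lerD2r lerD2r.
apply: (le_trans (ler_sum _ (fun a _ => drift_sqr_le a))).
rewrite big_split /= -!mulr_sumr -/(dispersion X).
have -> : (s + 4 * gamma ^+ 2 * L ^+ 2 / (1 - s)) * dispersion X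
    + 4 * n%:R * gamma ^+ 2 * vs ^+ 2 / (1 - s)
  = s * dispersion X + 2 * gamma ^+ 2 / (1 - s)
     * (2 * L ^+ 2 * dispersion X + 2 * n%:R * vs ^+ 2).
  by field; rewrite gt_eqF.
by rewrite lerD2l ler_wpM2l // divr_ge0 ?mulr_ge0 ?sqr_ge0 // ltW.
Qed.

End one_step.

(** * Independence of a fresh sample from the past *)
Section past.
Context (R : realType) (d : measure_display) (T : measurableType d).
Context (P : probability T R) (I : finType) (d' : I -> measure_display).
Context (S : forall i, measurableType (d' i)) (X : forall i, {RV P >-> S i}).

(** The finite intersections of events on the samples indexed by J: a pi-system
    that generates the sigma-algebra of these samples. *)
Definition cylinders (J : {set I}) : set (set T) :=
  [set E | exists2 A : forall i, set (S i), (forall i, measurable (A i)) &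
    E = [set w | forall i, i \in J -> A i (X i w)]].

Lemma cylinders_measurable J : cylinders J `<=` measurable.
Proof.
move=> _ [A mA ->].
have -> : [set w | forall i, i \in J -> A i (X i w)]
    = \bigcap_(i in [set i | i \in J]) (X i @^-1` A i) by [].
apply: fin_bigcap_measurable; first exact: finite_finset.
by move=> i _; rewrite -[X in measurable X]setTI; exact: measurable_funPT.
Qed.

Lemma cylindersI J : setI_closed (cylinders J).
Proof.
move=> _ _ [A mA ->] [B mB ->]; exists (fun i => A i `&` B i).
  by move=> i; exact: measurableI.
apply/seteqP; split => [w [hA hB] i iJ|w h]; first by split; [exact: hA|exact: hB].
by split => i iJ; have [] := h i iJ.
Qed.

Lemma cylindersT J : cylinders J setT.
Proof. by exists (fun=> setT) => //; apply/seteqP; split. Qed.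

(** The sample space, equipped with the sigma-algebra generated by the samples
    indexed by J.  A function that is measurable on this type is a function of
    these samples; no product of the spaces of the samples has to be built. *)
Definition past (J : {set I}) : Type := g_sigma_algebraType (cylinders J).
HB.instance Definition _ J := Measurable.on (past J).

Lemma past_id J : measurable_fun [set: T] (fun w : T => w : past J).
Proof.
apply: (@measurability _ _ T (past J) setT _ (cylinders J)) => //.
by move=> _ [E [A mA ->] <-]; rewrite setTI; apply: cylinders_measurable; exists A.
Qed.

Lemma past_sample (J : {set I}) (q : I) : q \in J ->
  measurable_fun [set: past J] (fun w : past J => X q w).
Proof.
move=> qJ _ B mB; rewrite setTI; apply: sub_sigma_algebra.
exists (@dfwith _ _ (fun i => [set: S i]) q B).
  move=> i; have [<-|/eqP qi] := eqVneq q i; first by rewrite dfwithin.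
  by rewrite dfwithout //; apply/eqP.
apply/seteqP; split => [w Bw i iJ|w /(_ q qJ)]; last by rewrite dfwithin.
have [<-|/eqP qi] := eqVneq q i; first by rewrite dfwithin.
by rewrite dfwithout //; apply/eqP.
Qed.

Hypothesis indep : mutually_independent X.

(** Both sides are finite measures of E, which agree on cylinders by mutual
    independence. *)
Lemma past_indep (J : {set I}) (q : I) (E : set T) (B : set (S q)) :
  q \notin J -> measurable (E : set (past J)) -> measurable B ->
  P (E `&` X q @^-1` B) = (P E * P (X q @^-1` B))%E.
Proof.
move=> qJ mE mB.
have mXB : measurable (X q @^-1` B).
  by rewrite -[Y in measurable Y]setTI; exact: measurable_funPT.
pose r : {nonneg R} := NngNum (fine_ge0 (measure_ge0 P (X q @^-1` B))).
have rE : (r%:num)%:E = P (X q @^-1` B) by rewrite /= fineK ?fin_num_measure.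
transitivity (mscale r P E); last by rewrite /mscale /= -rE muleC.
apply: (@g_sigma_algebra_measure_unique _ R T (cylinders J) _ (fun=> setT) _ _
  (mrestr P mXB) (mscale r P)) => //.
- exact: cylinders_measurable.
- by move=> _; exact: cylindersT.
- by rewrite bigcup_const.
- exact: cylindersI.
- move=> _ [A mA ->]; rewrite /mrestr /mscale -[RHS]muleC /= rE.
  pose A' := @dfwith _ _ A q B.
  have mA' i : measurable (A' i).
    rewrite /A'; have [<-|/eqP qi] := eqVneq q i; first by rewrite dfwithin.
    by rewrite dfwithout //; apply/eqP.
  have A'q : A' q = B by rewrite /A' dfwithin.
  have A'E i : i \in J -> A' i = A i.
    move=> iJ; rewrite /A' dfwithout //.
    by apply: contraNneq qJ => ->.
  transitivity (P [set w | forall i, i \in q |: J -> A' i (X i w)]).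
    congr (P _); apply/seteqP; split => [w [h Bw] i|w h].
      by rewrite in_setU1 => /orP[/eqP ->|iJ]; rewrite ?A'q // A'E //; exact: h.
    split => [i iJ|]; first by rewrite -A'E //; apply: h; rewrite in_setU1 iJ orbT.
    by rewrite /preimage /= -A'q; apply: h; rewrite in_setU1 eqxx.
  rewrite !indep // big_setU1 //= A'q muleC; congr (_ * _)%E.
  by apply: eq_bigr => i /A'E ->.
- by move=> _; rewrite /= /mrestr setTI (le_lt_trans (probability_le1 _ _)) ?ltry.
Qed.

Let past_proj (J : {set I}) (w : T) : past J := w.
HB.instance Definition _ J :=
  isMeasurableFun.Build _ _ T (past J) (past_proj J) (@past_id J).

Let past_pair (J : {set I}) (q : I) (w : T) : past J * S q := (past_proj J w, X q w).
Let measurable_past_pair J q : measurable_fun setT (past_pair J q).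
Proof. by apply: measurable_fun_pair; [exact: past_id|exact: measurable_funPT]. Qed.
HB.instance Definition _ J q :=
  isMeasurableFun.Build _ _ T (past J * S q)%type (past_pair J q)
    (@measurable_past_pair J q).

Variables (J : {set I}) (q : I) (D : probability (S q) R).
Hypotheses (qJ : q \notin J) (qD : has_distribution (X q) D).

Let m1 : probability (past J) R := distribution P (past_proj J : {RV P >-> past J}).

(** The joint law of the past and of a fresh sample is the product measure,
    because they agree on rectangles. *)
Let past_pair_law (g : past J * S q -> \bar R) :
  (\int[distribution P (past_pair J q : {RV P >-> (past J * S q)%type})]_z g z
   = \int[m1 \x D]_z g z)%E.
Proof.
apply: eq_measure_integral => A mA _; apply/esym.
apply: product_measure_unique => // E B mE mB.
transitivity (P (E `&` X q @^-1` B)); first by [].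
by rewrite past_indep //; congr (_ * _)%E; exact: qD.
Qed.

(** Tonelli's theorem, integrating over the fresh sample first. *)
Lemma integral_fresh_le (g : past J * S q -> R) (c : R) :
  @measurable_fun _ _ (past J * S q)%type R setT g -> (forall z, 0 <= g z) ->
  (forall w : past J, \int[D]_s (g (w, s))%:E <= c%:E)%E ->
  (\int[P]_w (g (w : past J, X q w))%:E <= c%:E)%E.
Proof.
move=> mg g0 gc.
have /measurable_EFinP mg' := mg.
have -> : (\int[P]_w (g (w : past J, X q w))%:E
    = \int[P]_w ((EFin \o g) \o past_pair J q) w)%E by [].
rewrite -ge0_integral_distribution //.
rewrite past_pair_law fubini_tonelli1 //.
have -> : c%:E = (\int[m1]_w (cst c%:E) w)%E.
  by rewrite integral_cst //; have /= -> := probability_setT m1; rewrite mule1.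
apply: ge0_le_integral => //.
- by move=> w _; apply: integral_ge0 => s _; rewrite lee_fin.
- by apply: (measurable_fun_fubini_tonelli_F (EFin \o g)) => // z; rewrite lee_fin.
- by move=> w _; exact: gc.
Qed.

(** Fubini's theorem, integrating over the fresh sample first. *)
Lemma integral_fresh_eq0 (g : past J * S q -> R) :
  @measurable_fun _ _ (past J * S q)%type R setT g ->
  P.-integrable setT (fun w => (g (w : past J, X q w))%:E) ->
  (forall w : past J, \int[D]_s (g (w, s))%:E = 0)%E ->
  (\int[P]_w (g (w : past J, X q w))%:E = 0)%E.
Proof.
move=> mg ig g0.
have /measurable_EFinP mg' := mg.
have -> : (\int[P]_w (g (w : past J, X q w))%:E
    = \int[P]_w ((EFin \o g) \o past_pair J q) w)%E by [].
rewrite -integral_distribution // past_pair_law.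
rewrite -integral12_prod_meas1 /=; last first.
  apply/integrableP; split => //.
  rewrite -past_pair_law ge0_integral_distribution //; last exact: measurableT_comp.
  by have /integrableP[] := ig.
by apply: integral0_eq => w _; exact: g0.
Qed.

End past.

(** * Joint measurability of the stochastic gradients *)
Section caratheodory.
Context (R : realType) (N : nat).
Context d1 d2 (A : measurableType d1) (S : measurableType d2).
Variables (F : 'cV[R]_N -> S -> R) (x : A -> 'cV[R]_N) (t : A -> S).
Hypothesis F_meas : forall y, measurable_fun setT (F y).
Hypothesis x_meas : forall j, measurable_fun setT (fun a => x a j 0).
Hypothesis t_meas : measurable_fun setT t.

(* The point x a is approximated by a point of the lattice of mesh 1 / (m + 1),
   which takes countably many values. *)
Let grid (m : nat) (a : A) : 'cV[int]_N :=
  \col_j Num.floor (m.+1%:R * x a j 0).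
Let node (m : nat) (z : 'cV[int]_N) : 'cV[R]_N :=
  \col_j ((z j 0)%:~R / m.+1%:R).

Let grid_meas m z : measurable (grid m @^-1` [set z]).
Proof.
have -> : grid m @^-1` [set z] = \bigcap_(j in [set: 'I_N])
    ((fun a => m.+1%:R * x a j 0) @^-1` `[(z j 0)%:~R, (z j 0 + 1)%:~R[%classic).
  apply/seteqP; split => [a /= <- j _|a h]; rewrite /= ?in_itv /=.
    by rewrite mxE floor_le_tmp floorD1_gt.
  apply/colP => j; rewrite mxE; apply/floor_def; have := h j I.
  by rewrite /= in_itv.
apply: fin_bigcap_measurable; first exact: finite_finset.
move=> j _; rewrite -[X in measurable X]setTI.
by apply: (measurable_funM (measurable_cst _) (x_meas j)).
Qed.

Let step_meas m : measurable_fun setT (fun a => F (node m (grid m a)) (t a)).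
Proof.
move=> _ B mB; rewrite setTI.
have -> : (fun a => F (node m (grid m a)) (t a)) @^-1` B =
    \bigcup_z (grid m @^-1` [set z] `&` t @^-1` (F (node m z) @^-1` B)).
  by apply/seteqP; split => [a h|a [z _ [/= -> //]]]; exists (grid m a).
apply: countable_bigcupT_measurable => // z.
apply: measurableI => //; rewrite -[X in measurable X]setTI; apply: t_meas => //.
by rewrite -[X in measurable X]setTI; exact: F_meas.
Qed.

Let node_cvg a : (fun m => node m (grid m a)) @ \oo --> x a.
Proof.
apply/cvg_ballP => e e0; near=> m; split => // i j; rewrite ord1 !mxE.
have m0 : 0 < m.+1%:R :> R by [].
rewrite /ball /= ger0_norm; last first.
  by rewrite subr_ge0 ler_pdivrMr // mulrC floor_le_tmp.
rewrite ltrBlDr -ltrBlDl ltr_pdivlMr // mulrBl.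
have : m.+1%:R * x a i 0 < (Num.floor (m.+1%:R * x a i 0))%:~R + 1.
  by rewrite -[1]/(1%:~R) -intrD floorD1_gt.
rewrite -ltrBlDr mulrC; apply: le_lt_trans; rewrite lerB //.
rewrite mulrC -ler_pdivrMl // mulr1.
by apply: ltW; near: m; exact: (near_infty_natSinv_lt (PosNum e0)).
Unshelve. all: end_near. Qed.

(** Replacing x a by lattice points gives functions that are measurable,
    being measurable on each of countably many pieces, and that converge
    pointwise by continuity in the first argument. *)
Lemma caratheodory_measurable : (forall s, continuous (F^~ s)) ->
  measurable_fun setT (fun a => F (x a) (t a)).
Proof.
move=> F_cont.
apply: (@measurable_fun_cvg _ _ _ setT (fun m a => F (node m (grid m a)) (t a))).
  exact: step_meas.
move=> a _; apply: (@cvg_comp _ _ _ _ (F^~ (t a)) _ _ _ (@node_cvg a)).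
exact: F_cont.
Qed.
End caratheodory.

(** A partial derivative is the limit of the difference quotients with steps
    1 / (m + 1). *)
Lemma measurable_grad (R : realType) (N : nat) d1 d2 (A : measurableType d1)
    (S : measurableType d2) (F : 'cV[R]_N -> S -> R) (x : A -> 'cV[R]_N)
    (t : A -> S) (j : 'I_N) :
  (forall s y, differentiable (F^~ s) y) ->
  (forall y, measurable_fun setT (F y)) ->
  (forall j, measurable_fun setT (fun a => x a j 0)) ->
  measurable_fun setT t ->
  measurable_fun setT (fun a => grad (F^~ (t a)) (x a) j 0).
Proof.
move=> dF mF mx mt.
have F_cont s : continuous (F^~ s).
  by move=> y; exact/differentiable_continuous.
pose h (m : nat) : R := m.+1%:R^-1.
apply: (@measurable_fun_cvg _ _ _ setT
  (fun m a => (h m)^-1 *: (F (h m *: delta_mx j 0 + x a) (t a) - F (x a) (t a)))).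
  move=> m; apply: measurable_funM => //; apply: measurable_funB.
    apply: caratheodory_measurable => // k.
    apply: (eq_measurable_fun
      (fun a => (h m *: delta_mx j (0 : 'I_1)) k 0 + x a k 0)).
      by move=> a _; rewrite [RHS]mxE.
    exact: measurable_funD.
  exact: caratheodory_measurable.
move=> a _; rewrite /grad mxE.
have := diff_derivable (dF (t a) (x a)) (v := delta_mx j 0).
move=> /cvgr_dnbhsP; apply; split => [m|]; first by rewrite invr_neq0.
exact: cvg_harmonic.
Qed.

(** * Integrable and square integrable real random variables *)
Section square_integrable.
Context (R : realType) (d : measure_display) (T : measurableType d).
Context (P : probability T R).
Implicit Types f g : T -> R.

Definition L1 (f : T -> R) : Prop := P.-integrable setT (EFin \o f).
Definition expect (f : T -> R) : R := \int[P]_w f w.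

Lemma eq_L1 f g : f =1 g -> L1 f -> L1 g.
Proof. by move=> /funext ->. Qed.

Lemma L1D f g : L1 f -> L1 g -> L1 (fun w => f w + g w).
Proof. by move=> If Ig; exact: (integrableD measurableT If Ig). Qed.

Lemma L1Z c f : L1 f -> L1 (fun w => c * f w).
Proof. by move=> If; exact: (integrableZl measurableT c If). Qed.

Lemma L1_cst c : L1 (fun=> c).
Proof. exact: finite_measure_integrable_cst. Qed.

Lemma L1_sum (I : Type) (r : seq I) (f : I -> T -> R) :
  (forall i, L1 (f i)) -> L1 (fun w => \sum_(i <- r) f i w).
Proof.
move=> If; elim: r => [|i r IH].
  by apply: (@eq_L1 (fun=> 0)) => [w|]; [rewrite big_nil|exact: L1_cst].
apply: (@eq_L1 (fun w => f i w + \sum_(j <- r) f j w)) => [w|].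
  by rewrite big_cons.
exact: L1D.
Qed.

Lemma L1_le f g : measurable_fun setT f -> (forall w, `|f w| <= g w) ->
  L1 g -> L1 f.
Proof.
move=> mf fg; apply: le_integrable => //; first exact/measurable_EFinP.
move=> w _; rewrite /= lee_fin (le_trans (fg w)) //; exact: ler_norm.
Qed.

Lemma L1_ge0 f c : measurable_fun setT f -> (forall w, 0 <= f w) ->
  (\int[P]_w (f w)%:E <= c%:E)%E -> L1 f.
Proof.
move=> mf f0 fc; apply/integrableP; split; first exact/measurable_EFinP.
apply: le_lt_trans (ltry c); rewrite (eq_integral (EFin \o f)) // => w _.
by rewrite /= ger0_norm.
Qed.

Lemma expectD f g : L1 f -> L1 g ->
  expect (fun w => f w + g w) = expect f + expect g.
Proof. exact: RintegralD. Qed.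

Lemma expectZ c f : L1 f -> expect (fun w => c * f w) = c * expect f.
Proof. by move=> If; exact: RintegralZl. Qed.

Lemma expect_cst c : expect (fun=> c) = c.
Proof.
rewrite /expect Rintegral_cst //.
by rewrite [X in fine X](_ : _ = 1%E) ?mulr1 //; exact: probability_setT. Qed.

Lemma expect_sum (I : Type) (r : seq I) (f : I -> T -> R) : (forall i, L1 (f i)) ->
  expect (fun w => \sum_(i <- r) f i w) = \sum_(i <- r) expect (f i).
Proof.
move=> If; elim: r => [|i r IH].
  rewrite big_nil -[RHS](expect_cst 0); congr expect.
  by apply/funext => w; rewrite big_nil.
rewrite big_cons -IH -expectD //; last exact: L1_sum.
by congr expect; apply/funext => w; rewrite big_cons.
Qed.

Lemma expect_le f g : L1 f -> L1 g -> (forall w, f w <= g w) -> expect f <= expect g.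
Proof. by move=> If Ig fg; apply: le_Rintegral. Qed.

Lemma expectationE f : L1 f -> ('E_P[f] = (expect f)%:E)%E.
Proof.
by move=> If; rewrite unlock /expect /Rintegral fineK //; exact: integrable_fin_num.
Qed.

Definition L2 (f : T -> R) : Prop :=
  measurable_fun setT f /\ L1 (fun w => f w ^+ 2).

Lemma L2_le f g : measurable_fun setT f -> (forall w, f w ^+ 2 <= g w) ->
  L1 g -> L2 f.
Proof.
move=> mf fg Ig; split => //; apply: L1_le Ig; first exact: measurable_funX.
by move=> w; rewrite ger0_norm // sqr_ge0.
Qed.

Lemma L2M f g : L2 f -> L2 g -> L1 (fun w => f w * g w).
Proof.
move=> [mf If] [mg Ig]; apply: (L1_le _ _ (L1D If Ig)).
  exact: measurable_funM.
move=> w; rewrite ler_norml.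
by apply/andP; split; have := sqr_ge0 (f w + g w); have := sqr_ge0 (f w - g w);
   have := sqr_ge0 (f w); have := sqr_ge0 (g w); nra.
Qed.

Lemma L2_cst c : L2 (fun=> c).
Proof. by split; [exact: measurable_cst|exact: L1_cst]. Qed.

Lemma L2D f g : L2 f -> L2 g -> L2 (fun w => f w + g w).
Proof.
move=> [mf If] [mg Ig].
apply: (@L2_le _ (fun w => 2 * f w ^+ 2 + 2 * g w ^+ 2)).
- exact: measurable_funD.
- by move=> w; rewrite -subr_ge0; have := sqr_ge0 (f w - g w); nra.
- by apply: L1D; exact: L1Z.
Qed.

Lemma L2Z c f : L2 f -> L2 (fun w => c * f w).
Proof.
move=> [mf If]; apply: (@L2_le _ (fun w => c ^+ 2 * f w ^+ 2)).
- by apply: measurable_funM => //; exact: measurable_cst.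
- by move=> w; rewrite exprMn.
- exact: L1Z.
Qed.

Lemma L2B f g : L2 f -> L2 g -> L2 (fun w => f w - g w).
Proof.
move=> Lf Lg; have := L2D Lf (L2Z (-1) Lg).
by congr L2; apply/funext => w; rewrite mulN1r.
Qed.

Lemma L2_sum (I : Type) (r : seq I) (f : I -> T -> R) :
  (forall i, L2 (f i)) -> L2 (fun w => \sum_(i <- r) f i w).
Proof.
move=> Lf; elim: r => [|i r IH].
  have := L2_cst 0; congr L2; apply/funext => w; by rewrite big_nil.
have := L2D (Lf i) IH; congr L2; apply/funext => w; by rewrite big_cons.
Qed.

Lemma L2_sqr f : L2 f -> L1 (fun w => f w ^+ 2).
Proof. by case. Qed.

End square_integrable.

(** * Moments and orthogonality of the noise *)

(** A Lipschitz gradient grows at most linearly. *)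
Lemma grad_L2 (R : realType) N L (g : 'cV[R]_N -> R) d (T : measurableType d)
    (P : probability T R) (y : T -> 'cV[R]_N) j : 0 < L -> lipschitz_grad L g ->
  (forall j, L2 P (fun w => y w j 0)) -> L2 P (fun w => grad g (y w) j 0).
Proof.
move=> L0 lg Ly.
apply: (@L2_le _ _ _ _ _ (fun w => 2 * L ^+ 2 * \sum_j y w j 0 ^+ 2
                             + 2 * grad g 0 j 0 ^+ 2)).
- apply: (@measurable_grad _ _ _ _ _ _ (fun y (_ : T) => g y) y id).
  + by move=> _ ?; have [] := lg.
  + by move=> ?; exact: measurable_cst.
  + by move=> k; have [] := Ly k.
  + exact: measurable_id.
- move=> w; have := lipschitz_grad_sqr (y w) 0 (ltW L0) lg.
  under [X in _ <= _ * X -> _]eq_bigr do rewrite [X in _ - X]mxE subr0.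
  move=> h; rewrite -mulrA; apply: (@le_trans _ _
    (2 * (grad g (y w) j 0 - grad g 0 j 0) ^+ 2 + 2 * grad g 0 j 0 ^+ 2)).
    rewrite -subr_ge0; move: (grad _ _ _ _) (grad _ _ _ _) => q p.
    by have := sqr_ge0 (p - q - q); nra.
  rewrite lerD2r ler_wpM2l // (le_trans _ h) //.
  by rewrite (bigD1 j) //= lerDl sumr_ge0 // => i _; exact: sqr_ge0.
- by apply: L1D; [apply: L1Z; apply: L1_sum => i; exact: L2_sqr|exact: L1_cst].
Qed.

Lemma cV_subE (R : realType) N (u v : 'cV[R]_N) a : (u - v) a 0 = u a 0 - v a 0.
Proof. by rewrite !mxE. Qed.

Section process.
Context (R : realType) (N n K : nat).
Context (d : 'I_n -> measure_display) (S : forall i, measurableType (d i)).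
Context (D : forall i, probability (S i) R) (F : forall i, 'cV[R]_N -> S i -> R).
Arguments F : clear implicits.
Hypothesis F_diff : forall i s x, differentiable (fun y => F i y s) x.
Hypothesis F_int : forall i x, (D i).-integrable setT (EFin \o F i x).
Context (W : 'M[R]_n) (L sigma gamma : R).
Context (dT : measure_display) (T : measurableType dT) (P : probability T R).
Context (xi : nat -> forall i : 'I_n, {RV P >-> S i}).
Hypothesis xi_law : forall k i, (k < K)%N -> has_distribution (xi k i) (D i).
Let sample := fun p : 'I_K * 'I_n => xi p.1 p.2.
Hypothesis xi_indep : mutually_independent sample.
Context (x0 : 'cV[R]_N).
Let f_ := local_obj D F.
Let X := dpsgd F W gamma x0 (fun k i => xi k i).
Hypothesis unbiased : forall i x j,
  ('E_(D i)[fun s => stoch_grad F x s j 0%R] = (grad (f_ i) x j 0%R)%:E)%E.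
Hypotheses (L0 : 0 < L) (lf : forall i, lipschitz_grad L (f_ i)).
Hypothesis bounded_var : forall i x,
  ('E_(D i)[fun s => (enorm (stoch_grad F x s - grad (f_ i) x) ^+ 2)%R]
     <= (sigma ^+ 2)%:E)%E.

Definition noise k i a w : R :=
  stoch_grad F (col i (X k w)) (xi k i w) a 0 - local_grad f_ (X k w) i a.

Lemma dpsgd_step k w a i : X k.+1 w a i =
  \sum_j W i j * X k w a j - gamma * (local_grad f_ (X k w) i a + noise k i a w).
Proof.
rewrite /X /= mxE 2!mxE summxE; congr (_ - _).
  by apply: eq_bigr => j _; rewrite !mxE.
by rewrite [in LHS]mxE /noise addrC subrK.
Qed.

Let F_meas i y : measurable_fun setT (F i y).
Proof. by apply/measurable_EFinP; have /integrableP[] := F_int i y. Qed.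

(** The samples indexed by J determine the iterate X_k. *)
Definition knows (k : nat) (J : {set 'I_K * 'I_n}) : Prop :=
  forall p : 'I_K * 'I_n, (p.1 < k)%N -> p \in J.

Lemma dpsgd_adapted k J a i : (k <= K)%N -> knows k J ->
  measurable_fun [set: past sample J] (fun w : past sample J => X k w a i).
Proof.
elim: k J a i => [|k IH] J a i kK kJ.
  by apply: (eq_measurable_fun (cst (x0 a 0))) => // w _; rewrite /X /= mxE.
have kJ' : knows k J by move=> p pk; apply: kJ; exact: ltnW.
apply: (eq_measurable_fun (fun w : past sample J => \sum_j W i j * X k w a j
    - gamma * stoch_grad F (col i (X k w)) (xi k i w) a 0)).
  move=> w _; rewrite dpsgd_step /noise; congr (_ - _ * _).
  by rewrite addrC subrK.
apply: measurable_funB; last apply: measurable_funM => //.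
  apply: measurable_sum => j; apply: measurable_funM => //.
  by apply: IH => //; exact: ltnW.
apply: measurable_grad => //.
  move=> j; apply: (eq_measurable_fun (fun w : past sample J => X k w j i)).
    by move=> w _; rewrite mxE.
  by apply: IH => //; exact: ltnW.
have := @past_sample _ _ _ _ _ _ _ sample J (Ordinal kK, i)
  (kJ (Ordinal kK, i) (ltnSn _)).
exact.
Qed.

Lemma measurable_local_grad dA (A : measurableType dA) (Y : A -> 'M[R]_(N, n)) i a :
  (forall b j, measurable_fun setT (fun w => Y w b j)) ->
  measurable_fun setT (fun w => local_grad f_ (Y w) i a).
Proof.
move=> mY.
apply: (@measurable_grad _ _ _ _ _ _ (fun y (_ : A) => f_ i y)
  (fun w => col i (Y w)) id).
- by move=> _ y; have [] := lf i.
- by move=> y; exact: measurable_cst.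
- move=> j; apply: (eq_measurable_fun (fun w => Y w j i)) => // w _.
  by rewrite mxE.
- exact: measurable_id.
Qed.

(* The noise as a function of the past, which fixes the iterate, and of the
   sample drawn at iteration k. *)
Let fresh (k : 'I_K) J i a (z : past sample J * S i) : R :=
  stoch_grad F (col i (X k z.1)) z.2 a 0 - local_grad f_ (X k z.1) i a.

Let measurable_fresh (k : 'I_K) J i a : knows k J ->
  measurable_fun setT (@fresh k J i a).
Proof.
move=> kJ.
have mX b j : measurable_fun [set: past sample J * S i] (fun z => X k z.1 b j).
  apply: (measurableT_comp (dpsgd_adapted b j (ltnW (ltn_ord k)) kJ)).
  exact: measurable_fst.
apply: measurable_funB; last by have := measurable_local_grad i a mX; exact.
have msnd := @measurable_snd _ _ (past sample J) (S i).
have := @measurable_grad _ _ _ _ _ _ (F i)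
  (fun z : past sample J * S i => col i (X k z.1)) snd a.
apply => //.
move=> j.
apply: (eq_measurable_fun (fun z : past sample J * S i => X k z.1 j i)) => //.
by move=> z _; rewrite mxE.
Qed.

Lemma noise_adapted (k : 'I_K) J i a : knows k J -> (k, i) \in J ->
  measurable_fun [set: past sample J] (fun w : past sample J => noise k i a w).
Proof.
move=> kJ kiJ.
have mxi : measurable_fun [set: past sample J] (fun w : past sample J => xi k i w).
  have := @past_sample _ _ _ _ _ _ _ sample J (k, i) kiJ.
  exact.
have mid : measurable_fun [set: past sample J] (fun w : past sample J => w).
  exact: measurable_id.
have := measurableT_comp (@measurable_fresh k J i a kJ)
  (measurable_fun_pair mid mxi).
exact.
Qed.

Let measurable_of_past (h : T -> R) J :
  measurable_fun [set: past sample J] (h : past sample J -> R) ->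
  measurable_fun [set: T] h.
Proof.
by move=> mh; have := measurableT_comp mh (@past_id _ _ _ _ _ _ _ sample J).
Qed.

Let before (k : nat) : {set 'I_K * 'I_n} := [set p : 'I_K * 'I_n | (p.1 < k)%N].
Let knows_before k : knows k (before k). Proof. by move=> p; rewrite inE. Qed.
Let before_fresh (k : 'I_K) i : (k, i) \notin before k.
Proof. by rewrite inE /= ltnn. Qed.

Lemma measurable_noise (k : 'I_K) i a : measurable_fun setT (noise k i a).
Proof.
apply: (@measurable_of_past _ ((k, i) |: before k)); apply: noise_adapted.
  by move=> p pk; rewrite !inE pk orbT.
by rewrite !inE eqxx.
Qed.

Let sampleD (k : 'I_K) i :
  @has_distribution _ _ _ _ (S (k, i).2) P (sample (k, i)) (D i).
Proof. exact: xi_law. Qed.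

Lemma noise_sqr_le (k : 'I_K) i :
  (\int[P]_w (\sum_a noise k i a w ^+ 2)%:E <= (sigma ^+ 2)%:E)%E.
Proof.
pose g (z : past sample (before k) * S i) := \sum_a @fresh k (before k) i a z ^+ 2.
have := @integral_fresh_le _ _ _ _ _ _ _ sample xi_indep (before k) (k, i)
  (D i) (before_fresh k i) (@sampleD k i) g (sigma ^+ 2).
apply.
- by apply: measurable_sum => a; apply: measurable_funX; exact: measurable_fresh.
- by move=> z; apply: sumr_ge0 => a _; exact: sqr_ge0.
- move=> w; have := bounded_var i (col i (X k w)).
  rewrite unlock; congr (_ <= _)%E; apply: eq_integral => s _.
  rewrite enorm_sqr; congr (_%:E); apply: eq_bigr => a _.
  by rewrite cV_subE.
Qed.

Lemma noise_sqr_L1 (k : 'I_K) i : L1 P (fun w => \sum_a noise k i a w ^+ 2).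
Proof.
have m : measurable_fun setT (fun w => \sum_a noise k i a w ^+ 2).
  by apply: measurable_sum => a; apply: measurable_funX; exact: measurable_noise.
apply: L1_ge0 m _ (noise_sqr_le k i) => w.
by apply: sumr_ge0 => a _; exact: sqr_ge0.
Qed.

Lemma expect_noise_sqr (k : 'I_K) i :
  expect P (fun w => \sum_a noise k i a w ^+ 2) <= sigma ^+ 2.
Proof.
rewrite -lee_fin -expectationE; last exact: noise_sqr_L1.
by rewrite unlock; exact: noise_sqr_le.
Qed.

Lemma noise_L2 (k : 'I_K) i a : L2 P (noise k i a).
Proof.
apply: L2_le (noise_sqr_L1 k i); first exact: measurable_noise.
by move=> w; rewrite (bigD1 a) //= lerDl sumr_ge0 // => b _; exact: sqr_ge0.
Qed.

(* Integrability follows from the finite variance. *)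
Let centred i x a :
  L1 (D i) (fun s : S i => stoch_grad F x s a 0 - grad (f_ i) x a 0) /\
  (\int[D i]_s (stoch_grad F x s a 0 - grad (f_ i) x a 0)%:E = 0)%E.
Proof.
have ms b : measurable_fun setT (fun s : S i => stoch_grad F x s b 0).
  have := @measurable_grad _ _ _ _ (S i) (S i) (F i) (fun=> x) id b.
  by apply.
pose c b (s : S i) := stoch_grad F x s b 0 - grad (f_ i) x b 0.
have mc b : measurable_fun setT (c b) by exact: measurable_funB.
have Ic : L1 (D i) (fun s => \sum_b c b s ^+ 2).
  have m : measurable_fun setT (fun s => \sum_b c b s ^+ 2).
    by apply: measurable_sum => b; apply: measurable_funX.
  apply: L1_ge0 m _ _ => [s|]; first by apply: sumr_ge0 => b _; exact: sqr_ge0.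
  have := bounded_var i x; rewrite unlock; congr (_ <= _)%E.
  apply: eq_integral => s _; congr (_%:E).
  by rewrite enorm_sqr; apply: eq_bigr => b _; rewrite cV_subE.
have Lc : L2 (D i) (c a).
  apply: L2_le Ic => // s.
  by rewrite (bigD1 a) //= lerDl sumr_ge0 // => b _; exact: sqr_ge0.
have Is : L1 (D i) (fun s : S i => stoch_grad F x s a 0).
  apply: (@eq_L1 _ _ _ _ (fun s => 1 * c a s + grad (f_ i) x a 0)) => [s|].
    by rewrite mul1r /c subrK.
  by apply: L1D; [apply: L2M; [exact: L2_cst|]|exact: L1_cst].
have Ec : L1 (D i) (c a) by apply: L1D => //; exact: L1_cst.
split => //; rewrite -[LHS]/(\int[D i]_s (c a s)%:E)%E.
have := expectationE Ec; rewrite unlock => ->.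
rewrite expectD //; last exact: L1_cst.
rewrite expect_cst.
have := expectationE Is; rewrite unbiased => -[<-].
by rewrite subrr.
Qed.

(** For a fixed past, the noise is the centred stochastic gradient at a fixed
    point, and h is a constant. *)
Lemma noise_orth (k : 'I_K) i J a (h : T -> R) :
  knows k J -> (k, i) \notin J ->
  measurable_fun [set: past sample J] (h : past sample J -> R) ->
  L2 P h -> expect P (fun w => h w * noise k i a w) = 0.
Proof.
move=> kJ kiJ mh Lh.
have Ih : L1 P (fun w => h w * noise k i a w) by apply: L2M => //; exact: noise_L2.
apply: EFin_inj; rewrite -expectationE // unlock.
pose g (z : past sample J * S i) := h z.1 * @fresh k J i a z.
have := @integral_fresh_eq0 _ _ _ _ _ _ _ sample xi_indep J (k, i)
  (D i) kiJ (@sampleD k i) g.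
apply => //.
- apply: measurable_funM; last exact: measurable_fresh.
  by have := measurableT_comp mh (@measurable_fst _ _ (past sample J) (S i)).
- move=> w; rewrite /g /=.
  under eq_integral do rewrite EFinM.
  have [Ic c0] := centred i (col i (X k w)) a.
  by rewrite -[RHS](mule0 (h w)%:E) -[in RHS]c0; exact: integralZl Ic _.
Qed.

(** By induction on k: X_(k+1) is an affine combination of X_k, of gradients at
    X_k and of noises. *)
Lemma dpsgd_L2 k a i : (k <= K)%N -> L2 P (fun w => X k w a i).
Proof.
elim: k a i => [|k IH] a i kK.
  by have := L2_cst P (x0 a 0); congr L2; apply/funext => w; rewrite /X /= mxE.
have Xk b j : L2 P (fun w => X k w b j) by apply: IH; exact: ltnW.
have -> : (fun w => X k.+1 w a i) = (fun w => \sum_j W i j * X k w a j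
    - gamma * (local_grad f_ (X k w) i a + noise k i a w)).
  by apply/funext => w; rewrite dpsgd_step.
apply: L2B; first by apply: L2_sum => j; exact: L2Z.
apply: L2Z; apply: L2D; last exact: (noise_L2 (Ordinal kK)).
apply: grad_L2 L0 (lf i) _ => j.
by have := Xk j i; congr L2; apply/funext => w; rewrite mxE.
Qed.

Lemma local_grad_L2 (k : 'I_K) i a : L2 P (fun w => local_grad f_ (X k w) i a).
Proof.
apply: grad_L2 L0 (lf i) _ => j.
have := dpsgd_L2 j i (ltnW (ltn_ord k)).
by congr L2; apply/funext => w; rewrite mxE.
Qed.

(** * Expectations along the iterations *)
Section network.
Hypotheses (n2 : (2 <= n)%N) (hW : sym_doubly_stochastic W).
Hypothesis rho1 : spectral_rho W < 1.
Let n0 : (0 < n)%N. Proof. exact: ltnW. Qed.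
Let nR0 : 0 < n%:R :> R. Proof. by rewrite ltr0n. Qed.

Lemma mean_L2 (u : 'I_n -> T -> R) :
  (forall i, L2 P (u i)) -> L2 P (fun w => mean (u ^~ w)).
Proof. by move=> Lu; apply: L2Z; exact: L2_sum. Qed.

Lemma full_grad_L2 (k : 'I_K) a : L2 P (fun w => full_grad f_ (X k w) a).
Proof.
apply: grad_L2 L0 (lipschitz_grad_avg n0 L0 lf) _ => j.
have -> : (fun w => avg_iterate (X k w) j 0) = (fun w => mean (X k w j)).
  by apply/funext => w; rewrite avg_iterateE.
by apply: mean_L2 => i; apply: dpsgd_L2; exact: ltnW.
Qed.

Lemma mean_adapted J (u : 'I_n -> T -> R) :
  (forall i, measurable_fun [set: past sample J] (u i : past sample J -> R)) ->
  measurable_fun [set: past sample J]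
    (fun w : past sample J => mean (fun i => u i w)).
Proof.
by move=> mu; apply: measurable_funM => //; exact: measurable_sum.
Qed.

Let X_past (k : 'I_K) b j :
  measurable_fun [set: past sample (before k)]
    (fun w : past sample (before k) => X k w b j).
Proof. by apply: dpsgd_adapted; [exact: ltnW|exact: knows_before]. Qed.

Let grad_past (k : 'I_K) i a : measurable_fun [set: past sample (before k)]
  (fun w : past sample (before k) => local_grad f_ (X k w) i a).
Proof. by have := measurable_local_grad i a (@X_past k). Qed.

Let mean_grad_past (k : 'I_K) a : measurable_fun [set: past sample (before k)]
  (fun w : past sample (before k) => mean_grad f_ (X k w) a).
Proof. by apply: (@mean_adapted _ (fun i w => local_grad f_ (X k w) i a)). Qed.

Let mean_grad_L2 (k : 'I_K) a : L2 P (fun w => mean_grad f_ (X k w) a).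
Proof.
apply: (@mean_L2 (fun i w => local_grad f_ (X k w) i a)) => i.
exact: local_grad_L2.
Qed.

Lemma drift_past (k : 'I_K) i a : measurable_fun [set: past sample (before k)]
  (fun w : past sample (before k) => drift W f_ gamma (X k w) i a).
Proof.
apply: measurable_funB.
  apply: measurable_funB; last exact: (@mean_adapted _ (fun j w => X k w a j)).
  by apply: measurable_sum => j; apply: measurable_funM.
by apply: measurable_funM => //; exact: measurable_funB.
Qed.

Lemma drift_L2 (k : 'I_K) i a : L2 P (fun w => drift W f_ gamma (X k w) i a).
Proof.
have LX j : L2 P (fun w => X k w a j) by apply: dpsgd_L2; exact: ltnW.
apply: L2B; last first.
  by apply: L2Z; apply: L2B; [exact: local_grad_L2|exact: mean_grad_L2].
by apply: L2B; [apply: L2_sum => j; exact: L2Z|exact: mean_L2].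
Qed.

Lemma expect_sum_orth (k : 'I_K) (h : 'I_N -> 'I_n -> T -> R) :
  (forall a i, measurable_fun [set: past sample (before k)]
     (h a i : past sample (before k) -> R)) ->
  (forall a i, L2 P (h a i)) ->
  L1 P (fun w => \sum_a \sum_i h a i w * noise k i a w) /\
  expect P (fun w => \sum_a \sum_i h a i w * noise k i a w) = 0.
Proof.
move=> mh Lh.
have I0 a i : L1 P (fun w => h a i w * noise k i a w).
  by apply: L2M => //; exact: noise_L2.
have I1 a : L1 P (fun w => \sum_i h a i w * noise k i a w) by exact: L1_sum.
split; first exact: L1_sum.
rewrite expect_sum // big1 // => a _; rewrite expect_sum // big1 // => i _.
exact: (noise_orth a (@knows_before k) (before_fresh k i)).
Qed.

(** The n^2 products in the square of the mean have zero expectation except for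
    the n diagonal ones. *)
Lemma expect_mean_noise_sqr (k : 'I_K) :
  L1 P (fun w => \sum_a mean (fun i => noise k i a w) ^+ 2) /\
  expect P (fun w => \sum_a mean (fun i => noise k i a w) ^+ 2) <= sigma ^+ 2 / n%:R.
Proof.
have Im a : L1 P (fun w => mean (fun i => noise k i a w) ^+ 2).
  by apply: L2_sqr; apply: mean_L2 => i; exact: noise_L2.
split; first exact: L1_sum.
have Ic i j a : L1 P (fun w => noise k i a w * noise k j a w).
  by apply: L2M; exact: noise_L2.
have cross i j a : i != j -> expect P (fun w => noise k i a w * noise k j a w) = 0.
  move=> ij; apply: (@noise_orth k j ((k, i) |: before k)).
  - by move=> p pk; rewrite !inE pk orbT.
  - by rewrite !inE ltnn orbF xpair_eqE eqxx eq_sym.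
  - apply: noise_adapted; last by rewrite !inE eqxx.
    by move=> p pk; rewrite !inE pk orbT.
  - exact: noise_L2.
rewrite expect_sum //.
have E a : expect P (fun w => mean (fun i => noise k i a w) ^+ 2)
    = n%:R ^- 2 * \sum_i expect P (fun w => noise k i a w ^+ 2).
  have -> : (fun w => mean (fun i => noise k i a w) ^+ 2)
    = (fun w => n%:R ^- 2 * \sum_i \sum_j noise k i a w * noise k j a w).
    apply/funext => w; rewrite /mean exprMn exprVn; congr (_ * _).
    by rewrite expr2 big_distrl /=; apply: eq_bigr => i _; rewrite big_distrr.
  have I1 i : L1 P (fun w => \sum_j noise k i a w * noise k j a w).
    exact: L1_sum.
  rewrite expectZ; last exact: L1_sum.
  congr (_ * _); rewrite expect_sum //; apply: eq_bigr => i _.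
  rewrite expect_sum // (bigD1 i) //= big1 ?addr0 // => j ji.
  by apply: cross; rewrite eq_sym.
under eq_bigr do rewrite E.
rewrite -mulr_sumr exchange_big /=.
have -> : sigma ^+ 2 / n%:R = n%:R ^- 2 * \sum_(i < n) sigma ^+ 2.
  by rewrite sumr_const card_ord -[sigma ^+ 2 *+ n]mulr_natl; field; rewrite gt_eqF.
rewrite ler_wpM2l ?invr_ge0 ?exprn_ge0 // ?(ltW nR0) //; apply: ler_sum => i _.
rewrite -expect_sum; first exact: expect_noise_sqr.
by move=> a; apply: L2_sqr; exact: noise_L2.
Qed.

Lemma dispersion_L1 k : (k <= K)%N -> L1 P (fun w => dispersion (X k w)).
Proof.
move=> kK; apply: L1_sum => a; apply: L1_sum => i; apply: L2_sqr; apply: L2B.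
  exact: dpsgd_L2.
by apply: mean_L2 => j; exact: dpsgd_L2.
Qed.

Lemma full_grad_sqr_L1 (k : 'I_K) :
  L1 P (fun w => \sum_a full_grad f_ (X k w) a ^+ 2).
Proof. by apply: L1_sum => a; apply: L2_sqr; exact: full_grad_L2. Qed.

Hypothesis g0 : 0 <= gamma.

Lemma expect_dispersion_step (k : 'I_K) (vs : R) :
  let s := Num.sqrt (spectral_rho W) in
  (forall x, n%:R^-1 * \sum_(i < n) enorm (grad (f_ i) x
     - grad (fun x => n%:R^-1 * \sum_i f_ i x) x) ^+ 2 <= vs ^+ 2) ->
  expect P (fun w => dispersion (X k.+1 w)) <=
    (s + 4 * gamma ^+ 2 * L ^+ 2 / (1 - s)) * expect P (fun w => dispersion (X k w))
    + 4 * n%:R * gamma ^+ 2 * vs ^+ 2 / (1 - s) + gamma ^+ 2 * (n%:R * sigma ^+ 2).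
Proof.
move=> s hvs.
have [I0 E0] := @expect_sum_orth k (fun a i w => drift W f_ gamma (X k w) i a)
   (fun a i => @drift_past k i a) (fun a i => @drift_L2 k i a).
have I1 : L1 P (fun w => \sum_a \sum_i noise k i a w ^+ 2).
  by do 2!(apply: L1_sum => ?); apply: L2_sqr; exact: noise_L2.
have E1 : expect P (fun w => \sum_a \sum_i noise k i a w ^+ 2) <= n%:R * sigma ^+ 2.
  have -> : (fun w => \sum_a \sum_i noise k i a w ^+ 2)
    = (fun w => \sum_i \sum_a noise k i a w ^+ 2).
    by apply/funext => w; rewrite exchange_big.
  rewrite expect_sum; last by move=> i; exact: noise_sqr_L1.
  rewrite mulr_natl -[X in _ *+ X]card_ord -sumr_const; apply: ler_sum => i _.
  exact: expect_noise_sqr.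
have I2 := dispersion_L1 (ltnW (ltn_ord k)).
have I3 := dispersion_L1 (ltn_ord k).
pose A := s + 4 * gamma ^+ 2 * L ^+ 2 / (1 - s).
pose B := 4 * n%:R * gamma ^+ 2 * vs ^+ 2 / (1 - s).
pose Y w := A * dispersion (X k w) + B
   + (- (2 * gamma)) * (\sum_a \sum_i drift W f_ gamma (X k w) i a * noise k i a w)
   + gamma ^+ 2 * (\sum_a \sum_i noise k i a w ^+ 2).
have J1 : L1 P (fun w => A * dispersion (X k w) + B).
  by apply: L1D; [exact: L1Z|exact: L1_cst].
have J2 : L1 P (fun w => A * dispersion (X k w) + B
   + (- (2 * gamma)) * (\sum_a \sum_i drift W f_ gamma (X k w) i a * noise k i a w)).
  by apply: L1D => //; exact: L1Z.
have IY : L1 P Y by apply: L1D => //; exact: L1Z.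
apply: (@le_trans _ _ (expect P Y)).
  apply: expect_le => // w; rewrite /Y mulNr.
  exact: (dispersion_step n2 hW rho1 L0 lf g0 (dpsgd_step k w) hvs).
rewrite /Y expectD //; last exact: L1Z.
rewrite (expectD J1); last exact: L1Z.
rewrite expectD; [|exact: L1Z|exact: L1_cst].
rewrite expect_cst !expectZ // E0 mulr0 addr0 lerD2l.
by rewrite ler_wpM2l // sqr_ge0.
Qed.

(** The values of f telescope along each trajectory, before the expectation is
    taken: only f (x0), which is deterministic, and the lower bound fstar are
    left. *)
Lemma sum_full_grad_le (fstar : R) : gamma * L <= 1 ->
  (forall x, fstar <= n%:R^-1 * \sum_i f_ i x) ->
  gamma / 2 * \sum_(k < K) expect P (fun w => \sum_a full_grad f_ (X k w) a ^+ 2)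
  <= n%:R^-1 * (\sum_i f_ i x0) - fstar
    + gamma * L ^+ 2 / (2 * n%:R)
      * \sum_(k < K) expect P (fun w => dispersion (X k w))
    + K%:R * (L * gamma ^+ 2 / 2 * (sigma ^+ 2 / n%:R)).
Proof.
move=> gL hmin.
pose f x := n%:R^-1 * \sum_i f_ i x.
pose coef (k : 'I_K) a w :=
  L * gamma ^+ 2 * mean_grad f_ (X k w) a - gamma * full_grad f_ (X k w) a.
have cross (k : 'I_K) :
   L1 P (fun w => \sum_a coef k a w * mean (fun i => noise k i a w))
   /\ expect P (fun w => \sum_a coef k a w * mean (fun i => noise k i a w)) = 0.
  have -> : (fun w => \sum_a coef k a w * mean (fun i => noise k i a w))
    = (fun w => \sum_a \sum_i (n%:R^-1 * coef k a w) * noise k i a w).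
    apply/funext => w; apply: eq_bigr => a _.
    by rewrite /mean mulrA [coef _ _ _ * _]mulrC big_distrr.
  apply: (@expect_sum_orth k (fun a i w => n%:R^-1 * coef k a w)) => a i.
    apply: measurable_funM => //.
    apply: measurable_funB; apply: measurable_funM => //.
    have lf' := lipschitz_grad_avg n0 L0 lf.
    have := @measurable_grad _ _ _ _ (past sample (before k))
      (past sample (before k))
      (fun y _ => f y) (fun w => avg_iterate (X k w)) id a; apply => //.
      by move=> _ y; have [] := lf'.
    move=> j; apply: (eq_measurable_fun
      (fun w : past sample (before k) => mean (X k w j))).
      by move=> w _; rewrite avg_iterateE.
    exact: (@mean_adapted _ (fun i w => X k w j i)).
  by apply: L2Z; apply: L2B; apply: L2Z; [exact: mean_grad_L2|exact: full_grad_L2].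
pose c1 := gamma * L ^+ 2 / (2 * n%:R); pose c2 := L * gamma ^+ 2 / 2.
pose B (k : 'I_K) w := (- (gamma / 2)) * (\sum_a full_grad f_ (X k w) a ^+ 2)
  + c1 * dispersion (X k w) + c2 * (\sum_a mean (fun i => noise k i a w) ^+ 2)
  + \sum_a coef k a w * mean (fun i => noise k i a w).
have step (k : 'I_K) w :
    f (avg_iterate (X k.+1 w)) - f (avg_iterate (X k w)) <= B k w.
  rewrite lerBlDl /B !addrA mulNr.
  exact: (descent_step n2 hW L0 lf g0 (dpsgd_step k w) gL).
have path w : fstar - f x0 <= \sum_k B k w.
  have e0 : avg_iterate (X 0%N w) = x0.
    apply/colP => a; rewrite avg_iterateE.
    have -> : X 0%N w a = fun=> x0 a 0 by apply/funext => i; rewrite /X /= mxE.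
    by rewrite mean_cst.
  have : \sum_(k < K) (f (avg_iterate (X k.+1 w)) - f (avg_iterate (X k w)))
      <= \sum_k B k w by apply: ler_sum => k _; exact: step.
  rewrite -(big_mkord xpredT
    (fun k => f (avg_iterate (X k.+1 w)) - f (avg_iterate (X k w)))).
  rewrite telescope_sumr // e0; apply: le_trans; rewrite lerD2r; exact: hmin.
have IF (k : 'I_K) := L1Z (- (gamma / 2)) (full_grad_sqr_L1 k).
have ID (k : 'I_K) := L1Z c1 (dispersion_L1 (ltnW (ltn_ord k))).
have IN (k : 'I_K) := L1Z c2 (expect_mean_noise_sqr k).1.
have IB k : L1 P (B k).
  by apply: L1D; [apply: L1D => //; apply: L1D|have [] := cross k].
have EB k : expect P (B k) <=
   - (gamma / 2) * expect P (fun w => \sum_a full_grad f_ (X k w) a ^+ 2)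
   + c1 * expect P (fun w => dispersion (X k w)) + c2 * (sigma ^+ 2 / n%:R).
  rewrite /B expectD; [|by apply: L1D => //; apply: L1D|by have [] := cross k].
  rewrite (cross k).2 addr0 expectD //; last exact: L1D.
  have IF' := full_grad_sqr_L1 k; have ID' := dispersion_L1 (ltnW (ltn_ord k)).
  have [IN' EN'] := expect_mean_noise_sqr k.
  rewrite expectD // !expectZ //.
  rewrite lerD2l ler_wpM2l //.
  by rewrite !mulr_ge0 ?sqr_ge0 // ltW.
have := expect_le (L1_cst P (fstar - f x0)) (L1_sum (index_enum 'I_K) IB) path.
rewrite expect_cst expect_sum // => h.
have := le_trans h (ler_sum _ (fun k _ => EB k)).
rewrite !big_split /= sumr_const card_ord -!mulr_sumr.
rewrite -[X in _ <= _ + _ + X]mulr_natl.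
rewrite mulNr -/(f x0) -/c1 -/c2; lra.
Qed.

End network.
End process.

(** * Choice of the step length *)

(** The bound 2 b / (1 - s) is the fixed point of the recursion with factor
    (1 + s) / 2. *)
Lemma geometric_bound (R : realFieldType) (y : nat -> R) (q b s : R) (K : nat) :
  0 <= s < 1 -> 0 <= b -> q <= (1 + s) / 2 -> y 0%N = 0 -> (forall k, 0 <= y k) ->
  (forall k, (k < K)%N -> y k.+1 <= q * y k + b) ->
  forall k, (k <= K)%N -> y k <= 2 * b / (1 - s).
Proof.
move=> /andP[s0 s1] b0 hq y0 yge hy.
have s1' : 0 < 1 - s by rewrite subr_gt0.
elim=> [|k IH] kK; first by rewrite y0 divr_ge0 ?mulr_ge0 // ltW.
apply: (le_trans (hy k kK)).
have h := IH (ltnW kK).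
have -> : 2 * b / (1 - s) = (1 + s) / 2 * (2 * b / (1 - s)) + b.
  by field; rewrite gt_eqF.
rewrite lerD2r; apply: (@le_trans _ _ ((1 + s) / 2 * y k)).
  by rewrite ler_wpM2r.
by rewrite ler_wpM2l // divr_ge0 // addr_ge0.
Qed.

(** In this part nr and Kr stand for the numbers of nodes and of iterations, r
    for sqrt (K / n), delta for f(0) - f^* and s for sqrt rho. *)
Section convergence_rate.
Context (R : realFieldType) (L sigma vs delta s nr Kr r gamma : R).
Hypotheses (L0 : 0 < L) (sigma0 : 0 < sigma) (delta0 : 0 <= delta).
Hypotheses (s0 : 0 <= s) (s1 : s < 1) (n2 : 2 <= nr) (r0 : 0 < r).
Hypothesis KE : Kr = nr * r ^+ 2.
Hypothesis gE : gamma = 1 / (2 * L + sigma * r).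
Let A := sigma ^+ 2 / (1 - s ^+ 2) + 9 * vs ^+ 2 / (1 - s) ^+ 2.
Hypothesis K1 :
  4 * L ^+ 4 * nr ^+ 5 / (sigma ^+ 6 * (delta + L) ^+ 2) * A ^+ 2 <= Kr.
Hypothesis K2 : 72 * L ^+ 2 * nr ^+ 2 / (sigma ^+ 2 * (1 - s) ^+ 2) <= Kr.

Let n0 : 0 < nr. Proof. exact: lt_le_trans n2. Qed.
Let s1' : 0 < 1 - s. Proof. by rewrite subr_gt0. Qed.
Let sr0 : 0 < sigma * r. Proof. exact: mulr_gt0. Qed.
Let den0 : 0 < 2 * L + sigma * r. Proof. by rewrite addr_gt0 // mulr_gt0. Qed.
Let sq1 : 0 < 1 - s ^+ 2.
Proof. by rewrite subr_gt0 expr_lt1. Qed.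

Lemma step_length_gt0 : 0 < gamma. Proof. by rewrite gE divr_gt0. Qed.

Lemma step_length_lipschitz : gamma * L <= 1.
Proof. by rewrite gE mul1r mulrC ler_pdivrMr // mul1r; move: L0 sr0 => ? ?; lra. Qed.

Lemma step_length_noise : gamma * (sigma * r) <= 1.
Proof. by rewrite gE mul1r mulrC ler_pdivrMr // mul1r; move: L0 sr0 => ? ?; lra. Qed.

(** The lower bound 72 L^2 n^2 / (sigma^2 (1 - s)^2) on K, combined with
    gamma sigma r <= 1, gives 72 n gamma^2 L^2 <= (1 - s)^2. *)
Lemma mixing_rate : s + 4 * gamma ^+ 2 * L ^+ 2 / (1 - s) <= (1 + s) / 2.
Proof.
have g0 := step_length_gt0.
have h1 : (gamma * (sigma * r)) ^+ 2 <= 1.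
  by rewrite expr_le1 ?step_length_noise // mulr_ge0 // ltW.
have h2 : 72 * L ^+ 2 * nr ^+ 2 <= nr * r ^+ 2 * (sigma ^+ 2 * (1 - s) ^+ 2).
  by move: K2; rewrite KE ler_pdivrMr // mulr_gt0 // exprn_gt0.
have h3 : 72 * L ^+ 2 * nr <= r ^+ 2 * (sigma ^+ 2 * (1 - s) ^+ 2).
  rewrite -(ler_pM2l n0); lra.
have h4 : gamma ^+ 2 * (72 * L ^+ 2 * nr) <= (1 - s) ^+ 2.
  apply: (@le_trans _ _ (gamma ^+ 2 * (r ^+ 2 * (sigma ^+ 2 * (1 - s) ^+ 2)))).
    by rewrite ler_wpM2l // sqr_ge0.
  have -> : gamma ^+ 2 * (r ^+ 2 * (sigma ^+ 2 * (1 - s) ^+ 2))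
    = (gamma * (sigma * r)) ^+ 2 * (1 - s) ^+ 2 by ring.
  by rewrite ler_piMl // sqr_ge0.
have h5 : 8 * (gamma ^+ 2 * L ^+ 2) <= (1 - s) ^+ 2.
  apply: le_trans h4; have := mulr_ge0 (sqr_ge0 gamma) (sqr_ge0 L).
  move: (gamma ^+ 2) (L ^+ 2) n2 => p q ? ?; nra.
have -> : (1 + s) / 2 = s + (1 - s) / 2 by field.
rewrite lerD2l ler_pdivrMr //; lra.
Qed.

(** The term in sigma^2 uses 1 - s^2 = (1 - s) (1 + s) and 1 + s <= 2. *)
Lemma dispersion_rate :
  2 * (4 * nr * gamma ^+ 2 * vs ^+ 2 / (1 - s)
       + gamma ^+ 2 * (nr * sigma ^+ 2)) / (1 - s)
    <= 4 * nr * gamma ^+ 2 * A.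
Proof.
rewrite -subr_ge0 /A.
have -> : 4 * nr * gamma ^+ 2
    * (sigma ^+ 2 / (1 - s ^+ 2) + 9 * vs ^+ 2 / (1 - s) ^+ 2)
  - 2 * (4 * nr * gamma ^+ 2 * vs ^+ 2 / (1 - s)
         + gamma ^+ 2 * (nr * sigma ^+ 2)) / (1 - s)
  = nr * gamma ^+ 2 * (28 * (vs / (1 - s)) ^+ 2 + 2 * sigma ^+ 2 / (1 + s)).
  by field; rewrite !gt_eqF // ltr_wpDr.
apply: mulr_ge0; first by rewrite mulr_ge0 ?sqr_ge0 // ltW.
apply: addr_ge0; first by rewrite mulr_ge0 ?sqr_ge0.
apply: divr_ge0; last exact: addr_ge0.
by apply: mulr_ge0 => //; exact: sqr_ge0.
Qed.

(** The hypothesis is the telescoped descent inequality with H the sum of the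
    expected squared gradients.  The square root of the first lower bound on K
    is 2 L^2 n^2 A <= r sigma^3 (delta + L); it makes the dispersion term at most
    2 (delta + L) sigma / (n^2 r), and n >= 2. *)
Lemma convergence_rate (H : R) :
  gamma / 2 * H <= delta
    + gamma * L ^+ 2 / (2 * nr) * (Kr * (4 * nr * gamma ^+ 2 * A))
    + Kr * (L * gamma ^+ 2 / 2 * (sigma ^+ 2 / nr)) ->
  H * Kr^-1 <= 8 * delta * L / Kr + (8 * delta + 4 * L) * sigma / (nr * r).
Proof.
move=> hH.
have g0 := step_length_gt0; have g1 := step_length_noise.
have K0 : 0 < Kr by rewrite KE mulr_gt0 // exprn_gt0.
have A0 : 0 <= A.
  apply: addr_ge0; apply: divr_ge0; rewrite ?sqr_ge0 ?(ltW sq1) //.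
  by apply: mulr_ge0 => //; exact: sqr_ge0.
have nr0 : 0 < nr * r by exact: mulr_gt0.
have h1 : H * Kr^-1 <= 2 * delta / (gamma * Kr) + 4 * L ^+ 2 * gamma ^+ 2 * A
    + L * gamma * sigma ^+ 2 / nr.
  have c0 : 0 <= 2 / (gamma * Kr) by rewrite divr_ge0 // mulr_ge0 // ltW.
  have := ler_wpM2l c0 hH; congr (_ <= _); field; rewrite !gt_eqF //.
have t1 : 2 * delta / (gamma * Kr)
    = 4 * delta * L / Kr + 2 * delta * sigma / (nr * r).
  by rewrite gE KE; field; rewrite !gt_eqF.
have t3 : L * gamma * sigma ^+ 2 / nr <= L * sigma / (nr * r).
  have -> : L * gamma * sigma ^+ 2 / nr
      = L * sigma / (nr * r) * (gamma * (sigma * r)).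
    by field; rewrite !gt_eqF.
  by rewrite ler_piMr // divr_ge0 ?mulr_ge0 // ltW.
have root : 2 * L ^+ 2 * nr ^+ 2 * A <= r * sigma ^+ 3 * (delta + L).
  rewrite -(@ler_pXn2r _ 2) // ?nnegrE; last 2 first.
  - by rewrite !mulr_ge0 ?(ltW L0) ?(ltW n0).
  - by rewrite !mulr_ge0 ?addr_ge0 ?(ltW r0) ?(ltW sigma0) ?(ltW L0).
  have dL : 0 < delta + L by rewrite ltr_wpDl.
  move: K1; rewrite KE mulrAC ler_pdivrMr; last first.
    by rewrite mulr_gt0 // exprn_gt0.
  move=> h; rewrite -(ler_pM2l n0); move: h.
  by congr (_ <= _); ring.
have t2 : 4 * L ^+ 2 * gamma ^+ 2 * A <= (delta + L) * sigma / (nr * r).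
  have -> : 4 * L ^+ 2 * gamma ^+ 2 * A
    = 2 * (gamma * (sigma * r)) ^+ 2 * (2 * L ^+ 2 * nr ^+ 2 * A)
       / (nr ^+ 2 * (sigma * r) ^+ 2) by field; rewrite !gt_eqF.
  rewrite ler_pdivrMr; last by rewrite mulr_gt0 // exprn_gt0.
  apply: (@le_trans _ _ (2 * 1 * (r * sigma ^+ 3 * (delta + L)))).
    apply: ler_pM => //.
    - by apply: mulr_ge0 => //; exact: sqr_ge0.
    - by rewrite !mulr_ge0 ?(ltW L0) ?(ltW n0).
    - by rewrite ler_pM2l // expr_le1 // mulr_ge0 // ltW.
  have -> : (delta + L) * sigma / (nr * r) * (nr ^+ 2 * (sigma * r) ^+ 2)
    = nr * (r * sigma ^+ 3 * (delta + L)) by field; rewrite !gt_eqF.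
  rewrite mulr1 ler_wpM2r //.
  by rewrite !mulr_ge0 ?addr_ge0 ?(ltW r0) ?(ltW sigma0) ?(ltW L0).
apply: (le_trans h1); rewrite t1.
have u1 : 0 <= delta * L / Kr by rewrite divr_ge0 ?mulr_ge0 // ltW.
have u2 : 0 <= delta * sigma / (nr * r) by rewrite divr_ge0 ?mulr_ge0 // ltW.
have u3 : 0 <= L * sigma / (nr * r) by rewrite divr_ge0 ?mulr_ge0 // ltW.
have e1 : 8 * delta * L / Kr = 8 * (delta * L / Kr) by ring.
have e2 : 4 * delta * L / Kr = 4 * (delta * L / Kr) by ring.
have e3 : 2 * delta * sigma / (nr * r) = 2 * (delta * sigma / (nr * r)) by ring.
have e4 : (8 * delta + 4 * L) * sigma / (nr * r)
  = 8 * (delta * sigma / (nr * r)) + 4 * (L * sigma / (nr * r)) by ring.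
have e5 : (delta + L) * sigma / (nr * r)
  = delta * sigma / (nr * r) + L * sigma / (nr * r) by ring.
rewrite e1 e2 e3 e4; rewrite e5 in t2; lra.
Qed.
End convergence_rate.

Unset Implicit Arguments.

Theorem corollary2 (R : realType) (N n K : nat)
  (hn : (2 <= n)%N) (hK : (1 <= K)%N)
  (* local distributions and losses *)
  (d : 'I_n -> measure_display) (S : forall i, measurableType (d i))
  (D : forall i, probability (S i) R)
  (F : forall i, 'cV[R]_N -> S i -> R)
  (F_diff : forall i s x, differentiable (fun y => F i y s) x)
  (F_int : forall i x, (D i).-integrable setT (EFin \o F i x))
  (* weight matrix *)
  (W : 'M[R]_n) (hW : sym_doubly_stochastic W)
  (* step length and algorithm; xi k i is the sample of node i at step k *)
  (L sigma varsigma gamma : R)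
  (dT : measure_display) (T : measurableType dT) (P : probability T R)
  (xi : nat -> forall i : 'I_n, {RV P >-> S i})
  (xi_law : forall k i, (k < K)%N -> has_distribution (xi k i) (D i))
  (xi_indep : mutually_independent (fun p : 'I_K * 'I_n => xi p.1 p.2))
  (x0 : 'cV[R]_N) (fstar : R) :
  let f_ := local_obj D F in
  let f := global_obj D F in
  let X := dpsgd F W gamma x0 (fun k i => xi k i) in
  let rho := spectral_rho W in
  is_minimum f fstar ->
  (* unbiased stochastic gradients, coordinate by coordinate *)
  (forall i x j, 'E_(D i)[fun s => stoch_grad F x s j 0%R]
                   = (grad (f_ i) x j 0%R)%:E)%E ->
  0 < L -> (forall i, lipschitz_grad L (f_ i)) ->
  rho < 1 ->
  0 < sigma -> 0 <= varsigma ->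
  (forall i x, 'E_(D i)[fun s => (enorm (stoch_grad F x s - grad (f_ i) x)
                                    ^+ 2)%R] <= (sigma ^+ 2)%:E)%E ->
  (forall x, n%:R^-1 * \sum_(i < n) enorm (grad (f_ i) x - grad f x) ^+ 2
               <= varsigma ^+ 2) ->
  (forall w, X 0%N w = 0) ->
  gamma = 1 / (2 * L + sigma * Num.sqrt (K%:R / n%:R)) ->
  4 * L ^+ 4 * n%:R ^+ 5 / (sigma ^+ 6 * (f 0 - fstar + L) ^+ 2)
    * (sigma ^+ 2 / (1 - rho)
       + 9 * varsigma ^+ 2 / (1 - Num.sqrt rho) ^+ 2) ^+ 2 <= K%:R ->
  72 * L ^+ 2 * n%:R ^+ 2 / (sigma ^+ 2 * (1 - Num.sqrt rho) ^+ 2) <= K%:R ->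
  ((\sum_(0 <= k < K)
      'E_P[fun w => (enorm (grad f (avg_iterate (X k w))) ^+ 2)%R])
     * (K%:R^-1)%:E
   <= (8 * (f 0 - fstar) * L / K%:R
       + (8 * f 0 - 8 * fstar + 4 * L) * sigma / Num.sqrt (K%:R * n%:R))%:E)%E.
Proof.
move=> f_ f X rho [fmin_ex fmin] unb L0 lf rho1 sigma0 vs0 bvar hvs hX0 gE K1 K2.
pose s := Num.sqrt rho.
have nR : 0 < n%:R :> R by rewrite ltr0n ltnW.
have KR : 0 < K%:R :> R by rewrite ltr0n.
have s0 : 0 <= s := sqrtr_ge0 _.
have s1 : s < 1 by rewrite -sqrtr1 ltr_sqrt.
have ss : rho = s ^+ 2 by rewrite sqr_sqrtr // sqr_ge0.
pose r := Num.sqrt (K%:R / n%:R : R).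
have r0 : 0 < r by rewrite sqrtr_gt0 divr_gt0.
have KE : K%:R = n%:R * r ^+ 2 :> R.
  by rewrite sqr_sqrtr ?divr_ge0 // ?ltW //; field; rewrite gt_eqF.
have nrE : Num.sqrt (K%:R * n%:R) = n%:R * r.
  have -> : K%:R * n%:R = (n%:R * r) ^+ 2 by rewrite KE; ring.
  by rewrite sqrtr_sqr ger0_norm // mulr_ge0 // ltW.
have delta0 : 0 <= f 0 - fstar by rewrite subr_ge0.
have n2 : 2 <= n%:R :> R by rewrite ler_nat.
have x00 : x0 = 0.
  apply/colP => a; have := hX0 point => /matrixP/(_ a (Ordinal (ltnW hn))).
  by rewrite /X /= !mxE.
rewrite -/r in gE; rewrite -/s in K1 K2; rewrite ss in K1.
have g0 := step_length_gt0 L0 sigma0 r0 gE.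
have gL := step_length_lipschitz L0 sigma0 r0 gE.
have mixing := mixing_rate L0 sigma0 s1 n2 r0 KE gE K2.
pose y k := expect P (fun w => dispersion (X k w)).
have y0 : y 0%N = 0.
  rewrite /y -[RHS](expect_cst P 0); congr expect; apply/funext => w.
  rewrite hX0 /dispersion; apply: big1 => a _; apply: big1 => i _.
  rewrite mxE (_ : mean _ = 0) ?subrr ?expr0n //.
  by rewrite /mean big1 ?mulr0 // => j _; rewrite mxE.
have yge k : 0 <= y k.
  by apply: Rintegral_ge0 => w _; exact: dispersion_ge0.
have x0E : n%:R^-1 * (\sum_i f_ i x0) = f 0 by rewrite x00.
have yK k : (k <= K)%N -> y k <= 4 * n%:R * gamma ^+ 2
    * (sigma ^+ 2 / (1 - s ^+ 2) + 9 * varsigma ^+ 2 / (1 - s) ^+ 2).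
  move=> kK; apply: le_trans (dispersion_rate sigma varsigma gamma s0 s1 n2).
  apply: (@geometric_bound _ y _ _ s K _ _ mixing y0 yge _ k kK).
  - by rewrite s0 s1.
  - apply: addr_ge0; last by rewrite !mulr_ge0 ?(ltW g0) ?(ltW nR) ?(ltW sigma0).
    by rewrite divr_ge0 ?subr_ge0 ?(ltW s1) // !mulr_ge0 ?(ltW g0) ?(ltW nR) ?vs0.
  - move=> j jK.
    have := expect_dispersion_step F_diff F_int xi_law xi_indep x0 unb L0 lf bvar
      hn hW rho1 (ltW g0) (Ordinal jK) hvs.
    by rewrite addrA.
have Hsum := sum_full_grad_le F_diff F_int xi_law xi_indep x0 unb L0 lf bvar
  hn hW (ltW g0) gL fmin.
pose G := \sum_(k < K) expect P (fun w => \sum_a full_grad f_ (X k w) a ^+ 2).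
pose M := 4 * n%:R * gamma ^+ 2
    * (sigma ^+ 2 / (1 - s ^+ 2) + 9 * varsigma ^+ 2 / (1 - s) ^+ 2).
have GE : (\sum_(0 <= k < K)
    'E_P[fun w => (enorm (grad f (avg_iterate (X k w))) ^+ 2)%R] = G%:E)%E.
  rewrite big_mkord /G -sumEFin; apply: eq_bigr => k _.
  rewrite -expectationE; last first.

    exact: (full_grad_sqr_L1 F_diff F_int W gamma xi_law xi_indep x0 L0 lf bvar hn).
  by congr ('E_P[_])%E; apply/funext => w; rewrite enorm_sqr.
rewrite GE -EFinM lee_fin nrE -mulrBr.
apply: (convergence_rate L0 sigma0 delta0 s0 s1 n2 r0 KE gE K1 (H := G)).
rewrite x0E in Hsum; apply: (le_trans Hsum).
rewrite lerD2r lerD2l ler_wpM2l //.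
  by rewrite divr_ge0 // !mulr_ge0 ?(ltW g0) ?(ltW L0) ?(ltW nR).
rewrite -/M mulr_natl -[X in _ *+ X]card_ord -sumr_const; apply: ler_sum => k _.
exact: yK (ltnW (ltn_ord k)).
Qed.
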